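(* Let $n\ge 2$, let $\sigma\ge 0$, let $z\in\mathbb{C}^n$ satisfy $|z_1|=\cdots=|z_n|=1$, let $W\in\mathbb{C}^{n\times n}$ be a Hermitian Gaussian Wigner matrix, and let $C=zz^*+\sigma W$. With probability at least $1-\mathcal{O}(n^{-5/4})$, the following holds for every global optimizer $x$ of the problem \[\max_{x\in\mathbb{C}^n} x^*Cx \quad\text{subject to } |x_1|=\cdots=|x_n|=1\] whose global phase is fixed so that $z^*x=|z^*x|$: \[\|x-z\|_\infty\le 6\left(\sqrt{\log n}+29\sigma\right)\sigma n^{-1/2},\qquad \|x-z\|_2\le 12\sigma;\] and furthermore, if $\sigma\le \frac{1}{18}n^{1/4}$, then the semidefinite program \[\max_{X\in\mathbb{C}^{n\times n}} \operatorname{tr}(CX)\quad\text{subject to } \operatorname{diag}(X)=\mathbf{1},\ X\succeq 0\] has the rank-one matrix $X=xx^*$ as its unique solution.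
   Context: A Hermitian Gaussian Wigner matrix $W$ is a random Hermitian matrix with $W_{ii}=0$ for all $i$, whose entries $W_{ij}$, $i<j$, are i.i.d. standard complex normal random variables ($\mathbb{E}W_{ij}=0$, $\mathbb{E}|W_{ij}|^2=1$, uniformly random phase), and $W_{ji}=\overline{W_{ij}}$. Here $\mathbf{1}$ is the all-ones vector, $\operatorname{diag}(X)$ is the vector of diagonal entries of $X$, $X\succeq 0$ means Hermitian positive semidefinite, $\|v\|_\infty=\max_i|v_i|$, and $\log$ is the natural logarithm. $z$ is deterministic. *)

(* Defs.v *)
From HB Require Import structures.
From mathcomp Require Import all_boot all_order all_algebra.
From mathcomp Require Import all_classical all_reals all_analysis.
From mathcomp Require Import normal_distribution.
From mathcomp Require Import complex.

Set Implicit Arguments.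
Unset Strict Implicit.
Unset Printing Implicit Defensive.

Import Order.TTheory GRing.Theory Num.Theory.
Local Open Scope ring_scope.
Local Open Scope classical_set_scope.

Definition cre {R : rcfType} (c : R[i]) : R := let: Complex a _ := c in a.
Definition cim {R : rcfType} (c : R[i]) : R := let: Complex _ b := c in b.
Definition cabs {R : rcfType} (c : R[i]) : R := Num.sqrt (cre c ^+ 2 + cim c ^+ 2).

Definition cadj {R : rcfType} m n (M : 'M[R[i]]_(m, n)) : 'M[R[i]]_(n, m) :=
  (map_mx Num.conj M)^T.

Definition cquad {R : rcfType} n (C : 'M[R[i]]_n) (x : 'cV[R[i]]_n) : R[i] :=
  (cadj x *m C *m x) 0 0.

Definition unimodular {R : rcfType} n (x : 'cV[R[i]]_n) : Prop :=
  forall i, cabs (x i 0) = 1.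

(* x is a global maximizer of x^* C x subject to |x_1| = ... = |x_n| = 1
   (the objective is compared through its real part; it is real for
   Hermitian C) *)
Definition phase_sync_opt {R : rcfType} n (C : 'M[R[i]]_n) (x : 'cV[R[i]]_n) :=
  unimodular x /\
  forall y : 'cV[R[i]]_n, unimodular y -> cre (cquad C y) <= cre (cquad C x).

Definition hermitian {R : rcfType} n (X : 'M[R[i]]_n) : Prop :=
  forall i j, X j i = Num.conj (X i j).

Definition psd {R : rcfType} n (X : 'M[R[i]]_n) : Prop :=
  hermitian X /\ forall v : 'cV[R[i]]_n, 0 <= cquad X v.

Definition sdp_feasible {R : rcfType} n (X : 'M[R[i]]_n) : Prop :=
  (forall i, X i i = 1) /\ psd X.

Definition sdp_obj {R : rcfType} n (C X : 'M[R[i]]_n) : R :=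
  cre (\tr (C *m X)).

Definition sdp_opt {R : rcfType} n (C X : 'M[R[i]]_n) : Prop :=
  sdp_feasible X /\ forall Y, sdp_feasible Y -> sdp_obj C Y <= sdp_obj C X.

Definition sdp_unique_solution {R : rcfType} n (C X0 : 'M[R[i]]_n) : Prop :=
  sdp_opt C X0 /\ forall X, sdp_opt C X -> X = X0.

(* Gaussian family: g b i j for i < j are mutually independent real
   N(0, 1/2) random variables (b = true: real part, b = false: imaginary part
   of W_ij). Entries with i >= j are unused. *)
Definition wigner_gaussians {R : realType} d (T : measurableType d)
    (P : probability T R) n (g : bool -> 'I_n -> 'I_n -> {RV P >-> R}) : Prop :=
  (forall b (i j : 'I_n), (i < j)%N -> forall A : set R, measurable A ->
     P (g b i j @^-1` A) = normal_prob 0 (Num.sqrt (2^-1)) A) /\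
  (forall B : bool -> 'I_n -> 'I_n -> set R, (forall b i j, measurable (B b i j)) ->
     P [set w | forall b (i j : 'I_n), (i < j)%N -> B b i j (g b i j w)] =
     (\prod_(b : bool) \prod_(i : 'I_n) \prod_(j : 'I_n | (i < j)%N)
        P (g b i j @^-1` B b i j))%E).

Definition wigner {R : realType} d (T : measurableType d)
    (P : probability T R) n (g : bool -> 'I_n -> 'I_n -> {RV P >-> R}) (w : T)
    : 'M[R[i]]_n :=
  \matrix_(i, j)
    if (i < j)%N then Complex (g true i j w) (g false i j w)
    else if (j < i)%N then Num.conj (Complex (g true j i w) (g false j i w))
    else 0.

(* Main.v *)
Require Import Defs.
From HB Require Import structures.
From mathcomp Require Import all_boot all_order all_algebra.
From mathcomp Require Import all_classical all_reals all_analysis.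
From mathcomp Require Import measurable_realfun normal_distribution.
From mathcomp Require Import complex.
From mathcomp Require Import zify ring lra.

(** Write q(u) = u^*Wu.  Only large n matters, since K may absorb the rest.

    Probability.  Linear forms in the entries of W are Gaussian, so Chernoff
    bounds |(Wz)_i| by sqrt(8 n log n) for all i, and |q(V)| by
    sqrt(11 n) |V|^2 for all integer vectors V in an l1-ball of radius 4n, of
    which there are at most (10000/81)^n < e^(11n/2).  As W has zero diagonal,
    q is affine in each real coordinate separately, so rounding the coordinates
    of u (scaled to |u|^2 = 2n) one at a time to integers can only increase
    q(u) - sqrt(11 n) |u|^2 up to the rounding error of |u|^2, a factor 5/4.
    Hence ||W||^2 <= (5/4)^2 11 n <= 18 n.

    Optimization.  Comparing x with z gives |x-z| |x+z| <= 4 sigma ||W||, hence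
    |x-z| <= 12 sigma.  Optimality in each coordinate gives (Cx)_i = mu_i x_i
    with mu_i > 0, and Cx = (z^*x) z + sigma Wx then yields the entrywise bound
    through Wx = Wz + W(x-z).  The same facts make S = diag(mu) - C positive
    definite on the orthogonal complement of x, while Sx = 0, so S certifies
    that xx^* is the unique solution of the semidefinite program. *)

Set Implicit Arguments.
Unset Strict Implicit.
Unset Printing Implicit Defensive.

Import Order.TTheory GRing.Theory Num.Theory.
Local Open Scope ring_scope.
Local Open Scope classical_set_scope.

(** * Gaussian tails for independent families *)

Section weighted_integral.
Import HBNNSimple.

(** The standard machine: the identity passes from indicators to simple functions by linearity and
    to [f] by monotone convergence on both sides. It serves both for independence, with [Y] the
    product of the other factors, and for a law with density [Y]. *)
Lemma ge0_integral_weight {R : realType} d1 d2 (T1 : measurableType d1)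
    (T2 : measurableType d2) (mu : {measure set T1 -> \bar R})
    (nu : {measure set T2 -> \bar R}) (X : T1 -> T2) (Y : T1 -> R) (c : R) :
  measurable_fun setT X -> measurable_fun setT Y -> (forall w, 0 <= Y w) ->
  (forall B : set T2, measurable B ->
    (\int[mu]_w (\1_B (X w) * Y w)%:E = c%:E * nu B)%E) ->
  forall f : T2 -> R, measurable_fun setT f -> (forall r, 0 <= f r) ->
    (\int[mu]_w (f (X w) * Y w)%:E = c%:E * \int[nu]_r (f r)%:E)%E.
Proof.
move=> mX mY Y0 hB f mf f0.
have mfE : measurable_fun setT (EFin \o f) by exact/measurable_EFinP.
pose h := nnsfun_approx measurableT mfE.
have mhX n : measurable_fun setT (fun w => h n (X w)) by exact: measurableT_comp.
have m1X (B : set T2) : measurable B -> measurable_fun setT (fun w => \1_B (X w) : R).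
  by move=> mB; apply: measurableT_comp.
have hn n : (\int[mu]_w (h n (X w) * Y w)%:E =
             c%:E * \int[nu]_r (h n r)%:E)%E.
  have mpre r : measurable (h n @^-1` [set r]) by [].
  transitivity (\sum_(y \in range (h n))
      (y%:E * (c%:E * nu (h n @^-1` [set y]))))%E.
    transitivity (\int[mu]_w (\sum_(y \in range (h n))
      (y%:E * (\1_(h n @^-1` [set y]) (X w) * Y w)%:E)))%E.
      apply: eq_integral => w _; rewrite EFinM fimfunE -fsumEFin//.
      rewrite ge0_mule_fsuml; last by move=> y; exact: nnfun_muleindic_ge0.
      by apply: eq_fsbigr => y _; rewrite -!EFinM mulrA.
    rewrite ge0_integral_fsum//; last 2 first.
    - move=> y; apply/measurable_EFinP/measurable_funM => //.
      by apply: measurable_funM => //; exact: m1X.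
    - move=> y w _; rewrite -EFinM mulrA EFinM mule_ge0 ?lee_fin//.
      exact: nnfun_muleindic_ge0.
    apply: eq_fsbigr => y; rewrite inE => -[t _ <-].
    rewrite ge0_integralZl//.
    + by rewrite hB.
    + by apply/measurable_EFinP/measurable_funM => //; exact: m1X.
    + by move=> w _; rewrite lee_fin mulr_ge0.
    + by rewrite lee_fin.
  have -> : (\int[nu]_r (h n r)%:E =
      \sum_(y \in range (h n)) (y%:E * nu (h n @^-1` [set y])))%E.
    transitivity (\int[nu]_r (\sum_(y \in range (h n))
      ((y * \1_(h n @^-1` [set y]) r)%:E)))%E.
      by apply: eq_integral => w _; rewrite fimfunE -fsumEFin.
    rewrite ge0_integral_fsum//; last 2 first.
    - by move=> y; apply/measurable_EFinP/measurable_funM => //; exact: measurable_indic.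
    - by move=> y w _; exact: nnfun_muleindic_ge0.
    apply: eq_fsbigr => y; rewrite inE => -[t _ <-].
    under eq_integral do rewrite EFinM.
    rewrite ge0_integralZl//.
    + congr (_ * _)%E.
      by rewrite -[X in nu X]setIT -integral_indic.
    + by apply/measurable_EFinP; exact: measurable_indic.
    + by rewrite lee_fin.
  (* The finite sum ranges over all reals, so the terms at negative [y] are dealt with too: their
     preimage under the nonnegative [h n] is empty. *)
  rewrite ge0_mule_fsumr; last first.
    move=> y; have [y0|y0] := leP 0 y; first by rewrite mule_ge0.
    by rewrite preimage_nnfun0// measure0 mule0.
  by apply: eq_fsbigr => y _; rewrite muleCA.
have cvgh r : EFin \o h^~ r @ \oo --> (f r)%:E.
  by apply: (@cvg_nnsfun_approx _ _ _ _ measurableT _ mfE) => // x _; rewrite lee_fin.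
have hle m n r : (m <= n)%N -> h m r <= h n r.
  by move=> mn; exact/lefP/nd_nnsfun_approx.
transitivity (limn (fun n => \int[mu]_w (h n (X w) * Y w)%:E))%E.
  rewrite -monotone_convergence//; last 3 first.
  - by move=> n; apply/measurable_EFinP/measurable_funM.
  - by move=> n w _; rewrite lee_fin mulr_ge0.
  - by move=> w _ m n mn; rewrite lee_fin ler_wpM2r ?hle.
  apply: eq_integral => w _; apply/esym/cvg_lim; first exact: ereal_hausdorff.
  have Yfin : (Y w)%:E \is a fin_num by [].
  exact: (cvgeZr Yfin (cvgh (X w))).
under eq_fun do rewrite hn.
rewrite limeMl//; last first.
  apply: ereal_nondecreasing_is_cvgn => m n mn.
  apply: ge0_le_integral => //.
  - by move=> w _; rewrite lee_fin.
  - exact/measurable_EFinP.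
  - exact/measurable_EFinP.
  - by move=> w _; rewrite lee_fin hle.
congr (_ * _)%E.
rewrite -monotone_convergence//; last 3 first.
- by move=> n; apply/measurable_EFinP.
- by move=> n w _; rewrite lee_fin.
- by move=> w _ m n mn; rewrite lee_fin hle.
apply: eq_integral => w _.
by apply/cvg_lim; [exact: ereal_hausdorff|exact: cvgh].
Qed.

End weighted_integral.

Section independence.
Context {R : realType} d (T : measurableType d) (P : probability T R).

Lemma indep_integral_prod (I : finType) (D : pred I) (X : I -> {RV P >-> R}) :
  (forall B : I -> set R, (forall i, measurable (B i)) ->
    P [set w | forall i, D i -> B i (X i w)] =
    (\prod_(i | D i) P (X i @^-1` B i))%E) ->
  forall (f : I -> R -> R) (m : I -> R),
  (forall i, measurable_fun setT (f i)) -> (forall i r, 0 <= f i r) ->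
  (forall i, D i -> (\int[P]_w (f i (X i w))%:E = (m i)%:E)%E) ->
  (\int[P]_w (\prod_(i | D i) f i (X i w))%:E = (\prod_(i | D i) m i)%:E)%E.
Proof.
move=> indep.
(* Generalized for induction: [s] lists the indices where [f i] may be arbitrary, and elsewhere
   [f i] is an indicator. For empty [s] this is the independence hypothesis. *)
suff H (s : seq I) (f : I -> R -> R) (m : I -> R) :
    (forall i, measurable_fun setT (f i)) -> (forall i r, 0 <= f i r) ->
    (forall i, D i -> (\int[P]_w (f i (X i w))%:E = (m i)%:E)%E) ->
    (forall i, i \notin s -> exists2 B : set R, measurable B & f i = \1_B) ->
    (\int[P]_w (\prod_(i | D i) f i (X i w))%:E = (\prod_(i | D i) m i)%:E)%E.
  by move=> f m mf f0 fm; apply: (H (enum I)) => // i; rewrite mem_enum.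
have mX i B : measurable B -> measurable (X i @^-1` B).
  by move=> mB; rewrite -[X i @^-1` _]setTI; exact: measurable_funP.
(* The indicators of the independence hypothesis are replaced one at a time. *)
elim: s f m => [|i0 s IHs] f m mf f0 fm fs.
  have /choice[B mB] : forall i, exists B : set R, measurable B /\ f i = \1_B.
    by move=> i; have [B ? ?] := fs i isT; exists B.
  have E : [set w | forall i, D i -> B i (X i w)] =
      \bigcap_(i in [set i | D i]) (X i @^-1` B i) by [].
  transitivity (P [set w | forall i, D i -> B i (X i w)]).
    rewrite -[X in P X]setIT -integral_indic//; last first.
      rewrite E; apply: fin_bigcap_measurable => // i _.
      by apply: mX; case: (mB i).
    apply: eq_integral => w _; congr EFin.
    rewrite indicE; have [wB|wB] := boolP (w \in _).
      move: wB; rewrite inE => wB; apply: big1 => i Di.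
      by rewrite (mB i).2 indicE mem_set//; exact: wB.
    have [i Di nB] : exists2 i, D i & ~ B i (X i w).
      apply: contrapT => h; move: wB; rewrite notin_setE; apply => i Di.
      by apply: contrapT => nB; apply: h; exists i.
    by rewrite (bigD1 i)//= (mB i).2 indicE memNset// mul0r.
  rewrite indep; last by move=> i; case: (mB i).
  rewrite -prodEFin; apply: eq_bigr => i Di.
  rewrite -fm// (mB i).2 -[X in P X]setIT -integral_indic//.
  by apply: mX; case: (mB i).
(* An index outside [D] occurs in no product, so its function may be replaced by the indicator of
   the whole line. *)
have [Di0|nDi0] := boolP (D i0); last first.
  pose f' i := if i == i0 then \1_setT else f i.
  pose m' i := if i == i0 then 1 else m i.
  have ne i : D i -> (i == i0) = false.
    by move=> Di; apply/eqP => ii0; move: nDi0; rewrite -ii0 Di.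
  have := IHs f' m'.
  under eq_integral.
    move=> w _; under eq_bigr do rewrite /f' ne//.
    over.
  under [X in _ = X%:E]eq_bigr do rewrite /m' ne//.
  apply.
  - by move=> i; rewrite /f'; case: ifP.
  - by move=> i r; rewrite /f'; case: ifP.
  - by move=> i Di; rewrite /f' /m' ne// fm.
  - move=> i si; rewrite /f'; case: ifP => [_|ii0]; first by exists setT.
    by apply: fs; rewrite inE negb_or ii0.
pose Y w := \prod_(i | D i && (i != i0)) f i (X i w).
have mY : measurable_fun setT Y.
  rewrite /Y; under eq_fun do rewrite -big_filter.
  by apply: measurable_prod => i _; exact: measurableT_comp.
have Y0 w : 0 <= Y w by apply: prodr_ge0.
have e w : \prod_(i | D i) f i (X i w) = f i0 (X i0 w) * Y w.
  by rewrite (bigD1 i0).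
under eq_integral do rewrite e.
(* With [Y] as weight and the law of [X i0] as [nu], it suffices to treat an indicator in place of
   [f i0], which is the induction hypothesis. *)
rewrite (ge0_integral_weight (c := \prod_(i | D i && (i != i0)) m i)
  (nu := distribution P (X i0)))//.
  rewrite (ge0_integral_distribution (X i0) (f := EFin \o f i0))//; last 2 first.
  - exact/measurable_EFinP.
  - by move=> r; rewrite lee_fin.
  by rewrite fm// -EFinM; congr EFin; rewrite mulrC [in RHS](bigD1 i0).
move=> B mB.
pose f' i := if i == i0 then \1_B else f i.
pose m' i := if i == i0 then fine (P (X i0 @^-1` B)) else m i.
have eL w : \prod_(i | D i) f' i (X i w) = \1_B (X i0 w) * Y w.
  rewrite (bigD1 i0)//= {1}/f' eqxx; congr (_ * _).
  by apply: eq_bigr => i /andP[_ /negbTE ii0]; rewrite /f' ii0.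
have eR : \prod_(i | D i) m' i =
    fine (P (X i0 @^-1` B)) * \prod_(i | D i && (i != i0)) m i.
  rewrite (bigD1 i0)//= {1}/m' eqxx; congr (_ * _).
  by apply: eq_bigr => i /andP[_ /negbTE ii0]; rewrite /m' ii0.
transitivity (\int[P]_w (\prod_(i | D i) f' i (X i w))%:E)%E.
  by apply: eq_integral => w _; rewrite eL.
transitivity ((\prod_(i | D i) m' i)%:E); last first.
  by rewrite eR mulrC EFinM fineK//; exact/fin_num_measure/mX.
apply: IHs.
- by move=> i; rewrite /f'; case: ifP => // _; exact: measurable_indic.
- by move=> i r; rewrite /f'; case: ifP.
- move=> i Di; rewrite /f' /m'; case: eqP => [->|_]; last exact: fm.
  rewrite fineK//; last exact/fin_num_measure/mX.
  by rewrite -[X in P X]setIT -integral_indic//; exact: mX.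
- move=> i si; rewrite /f'; case: ifPn => [_|ii0]; first by exists B.
  by apply: fs; rewrite inE negb_or ii0.
Qed.

End independence.

(** Completing the square: [expR (t * x)] times the centred density is a constant times the density
    of mean [t * s ^+ 2], whose integral is 1. *)
Lemma normal_mgf {R : realType} d (T : measurableType d) (P : probability T R)
    (X : {RV P >-> R}) (s t : R) : s != 0 ->
  (forall A : set R, measurable A -> P (X @^-1` A) = normal_prob 0 s A) ->
  (\int[P]_w (expR (t * X w))%:E = (expR (t ^+ 2 * s ^+ 2 / 2))%:E)%E.
Proof.
move=> s0 normalX.
have mE : measurable_fun setT (fun x : R => expR (t * x)).
  by apply: measurableT_comp => //; exact: measurable_funM.
transitivity (\int[distribution P X]_x (expR (t * x))%:E)%E.
  rewrite (ge0_integral_distribution X (f := fun x => (expR (t * x))%:E))//.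
  exact/measurable_EFinP.
(* [normal_prob] is a measure on [measurableTypeR R], whose display differs from
   that of [R]; [idfun] transports the integral between the two. *)
rewrite -[LHS]mul1e -(ge0_integral_weight (mu := lebesgue_measure)
  (X := idfun : measurableTypeR R -> R) (Y := normal_pdf 0 s))//; last 4 first.
- by move=> _ B mB; rewrite setTI preimage_id.
- exact: measurable_normal_pdf.
- by move=> x; exact: normal_pdf_ge0.
- move=> B mB; rewrite mul1e.
  transitivity (\int[lebesgue_measure]_(x in B) (normal_pdf 0 s x)%:E)%E; last first.
    by apply/esym; exact: normalX.
  rewrite [RHS]integral_mkcond.
  apply: eq_integral => x _; rewrite /patch indicE.
  by case: (x \in B); rewrite ?mul1r ?mul0r.
transitivity (\int[lebesgue_measure]_x
  ((expR (t ^+ 2 * s ^+ 2 / 2))%:E * (normal_pdf (t * s ^+ 2) s x)%:E))%E.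
  apply: eq_integral => x _; rewrite -EFinM; congr EFin.
  rewrite !normal_pdfE// !(mulrCA _ (normal_peak s)); congr (_ * _).
  have alg : t * x + - (x - 0) ^+ 2 / (s ^+ 2 *+ 2) =
      t ^+ 2 * s ^+ 2 / 2 + - (x - t * s ^+ 2) ^+ 2 / (s ^+ 2 *+ 2).
    by field; rewrite s0.
  by rewrite /normal_fun/= -!expRD alg.
rewrite ge0_integralZl//.
- by rewrite integral_normal_pdf mule1.
- by apply/measurable_EFinP; exact: measurable_normal_pdf.
- by move=> x _; rewrite lee_fin normal_pdf_ge0.
Qed.

Section chernoff_linear.
Context {R : realType} d (T : measurableType d) (P : probability T R).
Variables (I : finType) (D : pred I) (X : I -> {RV P >-> R}).
Hypothesis indep : forall B : I -> set R, (forall i, measurable (B i)) ->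
    P [set w | forall i, D i -> B i (X i w)] =
    (\prod_(i | D i) P (X i @^-1` B i))%E.
Variable s : R.
Hypothesis s0 : s != 0.
Hypothesis normalX : forall i, D i -> forall A : set R, measurable A ->
  P (X i @^-1` A) = normal_prob 0 s A.

Lemma measurable_linear (a : I -> R) :
  measurable_fun setT (fun w => \sum_(i | D i) a i * X i w).
Proof.
under eq_fun do rewrite -big_filter.
by apply: measurable_sum => i; exact: measurable_funM.
Qed.

Lemma linear_mgf (a : I -> R) t :
  (\int[P]_w (expR (t * \sum_(i | D i) a i * X i w))%:E =
   (expR (t ^+ 2 * s ^+ 2 * (\sum_(i | D i) a i ^+ 2) / 2))%:E)%E.
Proof.
have mE i : measurable_fun setT (fun x : R => expR (t * a i * x)).
  by apply: measurableT_comp => //; exact: measurable_funM.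
transitivity (\int[P]_w (\prod_(i | D i) expR (t * a i * X i w))%:E)%E.
  apply: eq_integral => w _; rewrite -expR_sum mulr_sumr; congr (expR _)%:E.
  by apply: eq_bigr => i _; rewrite mulrA.
rewrite (indep_integral_prod indep (f := fun i x => expR (t * a i * x))
  (m := fun i => expR ((t * a i) ^+ 2 * s ^+ 2 / 2)))//.
- rewrite -expR_sum mulr_sumr mulr_suml; congr (expR _)%:E.
  by apply: eq_bigr => i _; rewrite exprMn; ring.
by move=> i Di; rewrite (normal_mgf _ s0)//; exact: normalX.
Qed.

Lemma linear_chernoff (a : I -> R) (S t : R) : 0 < S -> 0 < t ->
  s ^+ 2 * \sum_(i | D i) a i ^+ 2 <= S ->
  (P [set w | t <= \sum_(i | D i) a i * X i w]%R
    <= (expR (- (t ^+ 2 / (2 * S))))%:E)%E.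
Proof.
move=> S0 t0 aS.
pose L : {RV P >-> R} := mfun_Sub (mem_set (measurable_linear a)).
(* The Chernoff parameter [t / S] minimizes r^2 S / 2 - r t over r. *)
have := chernoff L t (divr_gt0 t0 S0); move=> /le_trans; apply.
rewrite /mmt_gen_fun expectation_def/=.
under eq_integral do rewrite mulrC.
rewrite linear_mgf -EFinM lee_fin -expRD ler_expR.
set V := \sum_(i | D i) _ in aS *.
have -> : (t / S) ^+ 2 * s ^+ 2 * V / 2 - t / S * t =
    (t / S) ^+ 2 / 2 * (s ^+ 2 * V) - t / S * t by ring.
have -> : - (t ^+ 2 / (2 * S)) = (t / S) ^+ 2 / 2 * S - t / S * t.
  by field; rewrite gt_eqF.
by rewrite lerD2r ler_wpM2l// divr_ge0// sqr_ge0.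
Qed.

End chernoff_linear.

(** * Linear forms in the entries of a Wigner matrix *)

Section complex_parts.
Context {R : rcfType}.
Implicit Types c e : R[i].

Lemma creD c e : cre (c + e) = cre c + cre e. Proof. by case: c e => [? ?] []. Qed.
Lemma cimD c e : cim (c + e) = cim c + cim e. Proof. by case: c e => [? ?] []. Qed.
Lemma creN c : cre (- c) = - cre c. Proof. by case: c. Qed.
Lemma cimN c : cim (- c) = - cim c. Proof. by case: c. Qed.
Lemma creM c e : cre (c * e) = cre c * cre e - cim c * cim e.
Proof. by case: c e => [? ?] []. Qed.
Lemma cimM c e : cim (c * e) = cre c * cim e + cim c * cre e.
Proof. by case: c e => [? ?] [? ?]. Qed.
Lemma cre_conj c : cre (Num.conj c) = cre c. Proof. by case: c. Qed.
Lemma cim_conj c : cim (Num.conj c) = - cim c. Proof. by case: c. Qed.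
Lemma cre_real (x : R) : cre (x%:C)%C = x. Proof. by []. Qed.
Lemma cim_real (x : R) : cim (x%:C)%C = 0. Proof. by []. Qed.

Lemma complex_eqP c e : cre c = cre e -> cim c = cim e -> c = e.
Proof. by case: c e => [? ?] [? ?] /= -> ->. Qed.

Lemma cre_sum (I : Type) (r : seq I) (P : pred I) (F : I -> R[i]) :
  cre (\sum_(i <- r | P i) F i) = \sum_(i <- r | P i) cre (F i).
Proof. by apply: (big_morph cre creD). Qed.
Lemma sqr_cabs c : cabs c ^+ 2 = cre c ^+ 2 + cim c ^+ 2.
Proof. by rewrite /cabs sqr_sqrtr// addr_ge0// sqr_ge0. Qed.
Lemma cabs_ge0 c : 0 <= cabs c. Proof. exact: sqrtr_ge0. Qed.
Lemma norm_cabs c : `|c| = (cabs c)%:C%C. Proof. by case: c. Qed.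

Lemma cabsM c e : cabs (c * e) = cabs c * cabs e.
Proof. by apply: complexI; rewrite rmorphM/= -!norm_cabs normrM. Qed.
Lemma cabsN c : cabs (- c) = cabs c.
Proof. by apply: complexI; rewrite -!norm_cabs normrN. Qed.
Lemma cabs_conj c : cabs (Num.conj c) = cabs c.
Proof. by rewrite /cabs cre_conj cim_conj sqrrN. Qed.
Lemma cabsD c e : cabs (c + e) <= cabs c + cabs e.
Proof. by rewrite -lecR rmorphD/= -!norm_cabs ler_normD. Qed.
Lemma cabs_real (x : R) : 0 <= x -> cabs (x%:C)%C = x.
Proof. by move=> x0; rewrite /cabs/= expr0n addr0 sqrtr_sqr ger0_norm. Qed.
End complex_parts.

Lemma sum_offdiag_pair (V : nmodType) n (F : 'I_n -> 'I_n -> V) :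
  (forall i, F i i = 0) ->
  \sum_i \sum_j F i j =
  \sum_(i < n) \sum_(j < n | (i < j)%N) (F i j + F j i).
Proof.
move=> F0.
transitivity (\sum_(i < n) (\sum_(j < n | (i < j)%N) F i j +
  \sum_(j < n | (j < i)%N) F i j)).
  apply: eq_bigr => i _.
  rewrite (bigID (fun j : 'I_n => i < j)%N)/=; congr (_ + _).
  rewrite (bigD1 i)/=; last by rewrite ltnn.
  rewrite F0 add0r; apply: eq_bigl => j.
  by rewrite -leqNgt ltn_neqAle andbC.
rewrite big_split/= [X in _ + X](exchange_big_dep xpredT)//=.
by rewrite -big_split; apply: eq_bigr => i _; rewrite -big_split.
Qed.

Section wigner_linear.
Context {R : realType} d (T : measurableType d) (P : probability T R) n
  (g : bool -> 'I_n -> 'I_n -> {RV P >-> R}).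
Implicit Type B : 'M[R[i]]_n.

Let D (p : bool * ('I_n * 'I_n)) := (p.2.1 < p.2.2)%N.
Let X (p : bool * ('I_n * 'I_n)) := g p.1 p.2.1 p.2.2.
(** With c = B_ji + conj(B_ij), the pair i < j contributes Re(c W_ij) = Re c Re W_ij - Im c Im W_ij
    to the real part of tr(BW). Flat indices (b, (i, j)) make this one linear form in independent
    Gaussians. *)
Let coef B (p : bool * ('I_n * 'I_n)) :=
  let c := B p.2.2 p.2.1 + Num.conj (B p.2.1 p.2.2) in
  if p.1 then cre c else - cim c.

Let big_flat (S : Type) (idx : S) (op : Monoid.com_law idx)
   (F : bool * ('I_n * 'I_n) -> S) :
  \big[op/idx]_(p | D p) F p =
  \big[op/idx]_(b : bool) \big[op/idx]_(i : 'I_n)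
    \big[op/idx]_(j : 'I_n | (i < j)%N) F (b, (i, j)).
Proof.
under [RHS]eq_bigr do rewrite pair_big_dep/=.
by rewrite pair_big_dep; apply: eq_big => [[b [i j]]|[b [i j]]].
Qed.

Lemma wigner_traceE B w : cre (\tr (B *m wigner g w)) =
  \sum_(p | D p) coef B p * X p w.
Proof.
rewrite big_flat big_bool /= -big_split/=.
transitivity (\sum_i \sum_j cre (B j i * wigner g w i j)).
  rewrite /mxtrace cre_sum exchange_big/=; apply: eq_bigr => i _.
  by rewrite mxE cre_sum.
rewrite sum_offdiag_pair; last first.
  by move=> i; rewrite mxE ltnn mulr0.
apply: eq_bigr => i _; rewrite -big_split/=; apply: eq_bigr => j ij.
rewrite !mxE ij ltnNge (ltnW ij)/= /coef/= /X/=.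
rewrite !(creM, cre_conj, cim_conj, creD, cimD)/=; ring.
Qed.

Lemma measurable_wigner_trace B :
  measurable_fun setT (fun w => cre (\tr (B *m wigner g w))).
Proof. by under eq_fun do rewrite wigner_traceE; exact: measurable_linear. Qed.

(* The left-hand side of the last hypothesis is twice the variance of the trace. *)
Lemma wigner_trace_tail B (S t : R) : wigner_gaussians g -> 0 < S -> 0 < t ->
  \sum_(i < n) \sum_(j < n | (i < j)%N) cabs (B j i + Num.conj (B i j)) ^+ 2 <= 2 * S ->
  (P [set w | t <= cre (\tr (B *m wigner g w))]%R
    <= (expR (- (t ^+ 2 / (2 * S))))%:E)%E.
Proof.
move=> [gn gi] S0 t0 hS.
have -> : [set w | t <= cre (\tr (B *m wigner g w))] =
    [set w | t <= \sum_(p | D p) coef B p * X p w].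
  by apply/seteqP; split => w /=; rewrite wigner_traceE.
apply: (@linear_chernoff _ _ _ _ _ _ _ _ (Num.sqrt 2^-1)) => //.
- move=> A mA; rewrite big_flat.
  rewrite -(gi (fun b i j => A (b, (i, j))))//.
  congr (P _); apply/seteqP; split => w /= h.
    by move=> b i j ij; apply: (h (b, (i, j))).
  by move=> [b [i j]] ij; apply: (h b i j).
- by move=> [b [i j]] ij A mA; apply: gn.
rewrite sqr_sqrtr// big_flat big_bool/= -big_split/=.
rewrite ler_pdivrMl//; apply: le_trans hS.
apply: ler_sum => i _; rewrite -big_split/=; apply: ler_sum => j _.
by rewrite sqr_cabs /coef/= sqrrN.
Qed.
End wigner_linear.

(** * Operator norm of a Wigner matrix *)

Definition cform {R : rcfType} n (M : 'M[R[i]]_n) (u v : 'cV[R[i]]_n) : R[i] :=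
  (cadj u *m M *m v) 0 0.

Definition nsq {R : rcfType} n (u : 'cV[R[i]]_n) : R := \sum_i cabs (u i 0) ^+ 2.

Section forms.
Context {R : rcfType} {n : nat}.
Implicit Types (M : 'M[R[i]]_n) (u v w : 'cV[R[i]]_n).

Lemma cformE M u v : cform M u v = \sum_i \sum_j Num.conj (u i 0) * M i j * v j 0.
Proof.
rewrite /cform -mulmxA mxE; apply: eq_bigr => i _.
rewrite !mxE mulr_sumr; apply: eq_bigr => j _.
by rewrite mulrA.
Qed.

Lemma cquadE M u : cquad M u = cform M u u. Proof. by []. Qed.

Lemma cformDl M u v w : cform M (u + v) w = cform M u w + cform M v w.
Proof.
rewrite !cformE -big_split; apply: eq_bigr => i _; rewrite -big_split.
by apply: eq_bigr => j _; rewrite mxE rmorphD/= !mulrDl.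
Qed.

Lemma cformDr M u v w : cform M u (v + w) = cform M u v + cform M u w.
Proof. by rewrite /cform mulmxDr mxE. Qed.

Lemma cformZl M c u v : cform M (c *: u) v = Num.conj c * cform M u v.
Proof.
rewrite !cformE mulr_sumr; apply: eq_bigr => i _; rewrite mulr_sumr.
by apply: eq_bigr => j _; rewrite mxE rmorphM/= !mulrA.
Qed.

Lemma cformZr M c u v : cform M u (c *: v) = c * cform M u v.
Proof. by rewrite /cform -scalemxAr mxE. Qed.

Lemma conjc_real (x : R) : Num.conj (x%:C)%C = (x%:C)%C.
Proof. by rewrite /= /real_complex_def; apply: complex_eqP => //=; rewrite oppr0. Qed.

Lemma nsq_ge0 u : 0 <= nsq u.
Proof. by apply: sumr_ge0 => i _; rewrite sqr_ge0. Qed.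

Lemma nsq_eq0 u : nsq u = 0 -> u = 0.
Proof.
move=> /eqP; rewrite psumr_eq0; last by move=> i _; rewrite sqr_ge0.
move=> /allP h; apply/colP => i; rewrite mxE.
have := h i (mem_index_enum _); rewrite sqrf_eq0 => /eqP ci.
by apply/eqP; rewrite -normr_eq0 norm_cabs ci.
Qed.

Lemma nsqZ c u : nsq (c *: u) = cabs c ^+ 2 * nsq u.
Proof.
by rewrite /nsq mulr_sumr; apply: eq_bigr => i _; rewrite mxE cabsM exprMn.
Qed.
End forms.

(** * Rounding to integer vectors *)

(** An affine function on an interval is largest at an endpoint, so moving the coordinates one at a
    time never decreases [F]; the induction is on the list of coordinates already moved. *)
Lemma multiaffine_le_vertex {R : realFieldType} (K : finType)
    (F : (K -> R) -> R) (lo U : K -> R) :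
  (forall (V : K -> R) k, exists a b, forall t,
      F (fun j => if j == k then t else V j) = a + b * t) ->
  (forall k, lo k <= U k <= lo k + 1) ->
  exists V : K -> R, (forall k, V k = lo k \/ V k = lo k + 1) /\ F U <= F V.
Proof.
move=> aff loU.
suff H (s : seq K) : exists V : K -> R, [/\ forall k, k \in s ->
    V k = lo k \/ V k = lo k + 1, forall k, k \notin s -> V k = U k & F U <= F V].
  have [V [sV _ FV]] := H (enum K); exists V; split => // k.
  by apply: sV; rewrite mem_enum.
elim: s => [|k s [V [sV nsV FV]]]; first by exists U.
have [ks|nks] := boolP (k \in s).
  exists V; split => // j; rewrite inE; first by case/predU1P => [->|]; exact: sV.
  by rewrite negb_or => /andP[_]; exact: nsV.
have [a [b ab]] := aff V k.
have Vk : V = (fun j => if j == k then V k else V j).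
  by apply/funext => j; case: eqP => // ->.
(* The endpoint is chosen by the sign of the slope. *)
pose t := if 0 <= b then lo k + 1 else lo k.
exists (fun j => if j == k then t else V j); split.
- move=> j; rewrite inE; case: eqP => [-> _|_ /=]; last exact: sV.
  by rewrite /t; case: ifP; [right|left].
- by move=> j; rewrite inE negb_or => /andP[/negbTE -> ]; exact: nsV.
apply: (le_trans FV); have -> : F V = a + b * V k by rewrite [in LHS]Vk ab.
rewrite ab lerD2l nsV//.
have /andP[l1 l2] := loU k.
rewrite /t; case: ifPn => b0; first exact: ler_wpM2l.
by rewrite ler_wnM2l// ltW// ltNge.
Qed.

Definition cvec {R : rcfType} n (U : bool * 'I_n -> R) : 'cV[R[i]]_n :=
  \col_i Complex (U (true, i)) (U (false, i)).

Section lattice.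
Context {R : realType} {n : nat}.
Implicit Types (W : 'M[R[i]]_n).

Lemma nsq_cvec (U : bool * 'I_n -> R) : nsq (cvec U) = \sum_k U k ^+ 2.
Proof.
transitivity (\sum_b \sum_i U (b, i) ^+ 2); last first.
  by rewrite pair_bigA; apply: eq_bigr => -[].
rewrite big_bool/= -big_split.
by apply: eq_bigr => i _; rewrite sqr_cabs mxE.
Qed.

(** The coefficient of t^2 is e^*We, where e is a standard basis vector, possibly times the
    imaginary unit; this is a diagonal entry of W, hence zero. *)
Lemma cvec_affine W (U : bool * 'I_n -> R) k : (forall i, W i i = 0) ->
  exists a b, forall t,
    cre (cquad W (cvec (fun j => if j == k then t else U j))) = a + b * t.
Proof.
move=> W0; pose e : 'cV[R[i]]_n := cvec (fun j => (j == k)%:R).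
pose u := cvec (fun j => if j == k then 0 else U j).
exists (cre (cquad W u)), (cre (cform W u e + cform W e u)) => t.
have -> : cvec (fun j => if j == k then t else U j) = u + (t%:C)%C *: e.
  apply/colP => i; rewrite !mxE; apply: complex_eqP; rewrite /= ?creD ?cimD ?creM ?cimM /=.
    by case: eqP => _ /=; rewrite ?mulr1n ?mulr0n; ring.
  by case: eqP => _ /=; rewrite ?mulr1n ?mulr0n; ring.
have ee : cform W e e = 0.
  rewrite cformE; apply: big1 => i _; apply: big1 => j _.
  have [->|ij] := eqVneq i j; first by rewrite W0 mulr0 mul0r.
  suff : e i 0 = 0 \/ e j 0 = 0.
    by move=> [->|->]; rewrite ?rmorph0 ?mul0r ?mulr0.
  have eE m : e m 0 = Complex ((true, m) == k)%:R ((false, m) == k)%:R.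
    by rewrite mxE.
  rewrite !eE; case: (k) => b l.
  have [il|il] := eqVneq i l; [right|left]; apply: complex_eqP => /=;
    by rewrite xpair_eqE -?il ?[j == i]eq_sym ?(negbTE ij) ?(negbTE il) andbF.
rewrite cquadE cformDl !cformDr !cformZl !cformZr ee conjc_real.
by rewrite !(creD, creM, cim_real, cre_real)/=; ring.
Qed.

Lemma quad_le_of_lattice W (al : R) : (forall i, W i i = 0) -> 0 <= al ->
  (forall v : bool * 'I_n -> int, (\sum_k `|v k| <= 4 * n)%N ->
    cre (cquad W (cvec (fun k => (v k)%:~R))) <= al * \sum_k (v k)%:~R ^+ 2) ->
  forall u, cre (cquad W u) <= 5 / 4 * al * nsq u.
Proof.
move=> W0 al0 hv.
(* The scale 2n is the number of real coordinates, so the mean square of a coordinate is 1 and a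
   rounding loss of 1/4 per coordinate costs the factor 5/4. *)
have key (U : bool * 'I_n -> R) : \sum_k U k ^+ 2 = (2 * n)%:R ->
    cre (cquad W (cvec U)) <= 5 / 4 * al * (2 * n)%:R.
  move=> U2; pose fl k : int := Num.floor (U k).
  pose lo k : R := (fl k)%:~R.
  have loU k : lo k <= U k <= lo k + 1.
    by have /andP[-> /ltW] := floor_itv (U k); rewrite intrD.
  (* [phi k] is the chord of the square function over [lo k, lo k + 1]. *)
  pose phi k t := (2 * lo k + 1) * t - lo k * (lo k + 1).
  (* The chord makes [F] affine in each coordinate, and at the vertices, where chord and square
     agree, [F] is the quantity bounded by [hv]. *)
  pose F (V : bool * 'I_n -> R) := cre (cquad W (cvec V)) - al * \sum_k phi k (V k).
  have [|V [sV FUV]] := @multiaffine_le_vertex R _ F lo U _ loU.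
    move=> V k; have [a [b ab]] := cvec_affine V k W0.
    exists (a - al * (\sum_(j | j != k) phi j (V j) - lo k * (lo k + 1))).
    exists (b - al * (2 * lo k + 1)) => t.
    rewrite /F ab (bigD1 k)//= eqxx.
    rewrite (eq_bigr (fun j => phi j (V j))); last by move=> j /negbTE ->.
    by rewrite /phi; ring.
  pose v k : int := if V k == lo k then fl k else fl k + 1.
  have vV k : V k = (v k)%:~R.
    by rewrite /v; case: eqP => // lV; case: (sV k) => // ->; rewrite intrD.
  have phiV k : phi k (V k) = V k ^+ 2.
    by rewrite /phi; case: (sV k) => ->; ring.
  (* The chord exceeds the square by (t - lo)(lo + 1 - t), which is at most 1/4. *)
  have phiU k : phi k (U k) <= U k ^+ 2 + 4^-1.
    have : 0 <= (U k - lo k - 2^-1) ^+ 2 by exact: sqr_ge0.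
    by rewrite /phi => h; lra.
  have card2n (c : R) : \sum_(k : bool * 'I_n) c = c * (2 * n)%:R.
    by rewrite sumr_const card_prod card_bool card_ord mulr_natr.
  (* Since |v_k| <= |U_k| + 1 <= U_k^2 / 2 + 3/2, the sum over the 2n coordinates is at most n +
     3n. *)
  have v1 : (\sum_k `|v k| <= 4 * n)%N.
    rewrite -(ler_nat R) natr_sum.
    apply: (@le_trans _ _ (\sum_k (U k ^+ 2 / 2 + 3 / 2))).
      apply: ler_sum => k _; rewrite natr_absz intr_norm -vV ler_norml.
      have /andP[l1 l2] := loU k.
      have h1 : 0 <= (U k - 1) ^+ 2 by exact: sqr_ge0.
      have h2 : 0 <= (U k + 1) ^+ 2 by exact: sqr_ge0.
      by case: (sV k) => ->; apply/andP; split; lra.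
    rewrite big_split/= -mulr_suml U2 card2n !natrM; lra.
  have FV0 : F V <= 0.
    rewrite /F subr_le0 (eq_bigr _ (fun k _ => phiV k)).
    have := hv _ v1; congr (cre (cquad W _) <= al * _).
      by apply/colP => i; rewrite !mxE -!vV.
    by apply: eq_bigr => k _; rewrite -vV.
  have : cre (cquad W (cvec U)) <= al * \sum_k phi k (U k).
    by rewrite -subr_le0; exact: le_trans FUV FV0.
  move=> /le_trans; apply.
  have -> : 5 / 4 * al * (2 * n)%:R = al * (5 / 4 * (2 * n)%:R) by ring.
  apply: ler_wpM2l => //.
  apply: (le_trans (ler_sum _ (fun k _ => phiU k))).
  rewrite big_split/= U2 card2n; lra.
move=> u.
have [u0|u0] := eqVneq (nsq u) 0.
  by rewrite u0 mulr0 (nsq_eq0 u0) cquadE /cform mulmx0 mxE lexx.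
have un : 0 < nsq u by rewrite lt_neqAle eq_sym u0 nsq_ge0.
pose c := Num.sqrt ((2 * n)%:R / nsq u).
have c2 : c ^+ 2 = (2 * n)%:R / nsq u by rewrite sqr_sqrtr// divr_ge0 ?nsq_ge0.
pose U (k : bool * 'I_n) := c * (if k.1 then cre (u k.2 0) else cim (u k.2 0)).
have cU : cvec U = (c%:C)%C *: u.
  apply/colP => i; rewrite !mxE; apply: complex_eqP;
   rewrite /= ?creM ?cimM cre_real cim_real /U/=; ring.
have n0 : (0 < n)%N.
  rewrite lt0n; apply: contraNneq u0 => n0; rewrite /nsq big1// => m _.
  by exfalso; have := ltn_ord m; rewrite [X in (_ < X)%N]n0.
have c20 : 0 < c ^+ 2 by rewrite c2 divr_gt0// ltr0n muln_gt0.
have := key U; rewrite -nsq_cvec cU nsqZ cabs_real ?sqrtr_ge0//.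
rewrite {1}c2 divfK// => /(_ erefl).
rewrite cquadE cformZl cformZr conjc_real !creM !cre_real !cim_real !mul0r !subr0.
rewrite mulrA -expr2 -ler_pdivlMl// => /le_trans; apply.
have N0 : (2 * n)%:R != 0 :> R by rewrite pnatr_eq0 muln_eq0/= -lt0n.
rewrite c2; move: N0; move: ((2 * n)%:R : R) => N N0.
rewrite le_eqVlt; apply/orP; left; apply/eqP; field.
by rewrite ?u0 ?N0.
Qed.
End lattice.

(** * Union bound and counting of lattice points *)

Lemma union_bound {R : realType} d (T : measurableType d) (P : probability T R)
    (K : finType) (Q : pred K) (f : K -> T -> R) (t e : K -> R) :
  (forall k, Q k -> measurable_fun setT (f k)) ->
  (forall k, Q k -> (P [set w | t k <= f k w]%R <= (e k)%:E)%E) ->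
  exists E, [/\ measurable E, (P E >= (1 - \sum_(k | Q k) e k)%:E)%E &
    forall w, E w -> forall k, Q k -> f k w < t k].
Proof.
move=> mf hf; pose B k := [set w | t k <= f k w]%R.
have mB k : Q k -> measurable (B k).
  by move=> Qk; rewrite -[B k]setTI; apply: measurable_fun_le => //; exact: mf.
have [mU PU] : measurable (\big[setU/set0]_(k | Q k) B k) /\
    (P (\big[setU/set0]_(k | Q k) B k) <= (\sum_(k | Q k) e k)%:E)%E.
  elim/big_rec2 : _ => [|k x A Qk [mA PA]]; first by rewrite measure0.
  split; first by apply: measurableU => //; exact: mB.
  apply: (le_trans (measureU2 _ (mB _ Qk) mA)).
  by rewrite EFinD leeD ?hf.
exists (~` \big[setU/set0]_(k | Q k) B k); split; first exact: measurableC.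
  by rewrite probability_setC// EFinB leeB.
move=> w nU k Qk; rewrite ltNge; apply/negP => h; apply: nU.
by rewrite (bigD1 k)//=; left.
Qed.

(** The index a stands for the integer a - m in [-m, m]. Splitting at a = m leaves two geometric
    sums, one starting at q and one at 1. *)
Lemma sum_lattice_weight {R : numFieldType} (q : R) (m : nat) : 0 <= q -> q < 1 ->
  \sum_(a < (2 * m).+1) q ^+ `|(a : nat)%:Z - m%:Z|%N <= (1 + q) / (1 - q).
Proof.
move=> q0 q1; have q1' : 0 < 1 - q by rewrite subr_gt0.
have geo k : \sum_(i < k) q ^+ i <= (1 - q)^-1.
  rewrite -(ler_pM2l q1') mulfV ?gt_eqF//.
  rewrite -opprB mulNr -subrX1 opprB lerBlDr lerDl exprn_ge0//.
have -> : \sum_(a < (2 * m).+1) q ^+ `|(a : nat)%:Z - m%:Z|%N =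
   q * \sum_(i < m) q ^+ i + \sum_(i < m.+1) q ^+ i.
  have -> : (2 * m).+1 = (m + m.+1)%N by rewrite mulSn mul1n addnS.
  rewrite big_split_ord/=; congr (_ + _).
    rewrite mulr_sumr (reindex_inj rev_ord_inj)/=; apply: eq_bigr => i _.
    by rewrite -exprS; congr (_ ^+ _); have := ltn_ord i; lia.
  by apply: eq_bigr => i _; congr (_ ^+ _); lia.
rewrite mulrDl mul1r addrC lerD//; exact: ler_wpM2l.
Qed.

(* Each point of the ball has weight at least [q ^+ M] under the product of the
   two-sided geometric weights. *)
Lemma card_lattice_ball {R : realFieldType} (I : finType) (m M : nat) (q : R) :
  0 < q -> q < 1 ->
  #|[pred V : {ffun I -> 'I_(2 * m).+1} |
     (\sum_k `|(V k : nat)%:Z - m%:Z|%N <= M)%N]|%:R * q ^+ M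
  <= ((1 + q) / (1 - q)) ^+ #|I|.
Proof.
move=> q0 q1; set A := [pred V | _].
apply: (@le_trans _ _ (\sum_(V : {ffun I -> 'I_(2 * m).+1})
    \prod_k q ^+ `|(V k : nat)%:Z - m%:Z|%N)).
  rewrite (bigID (mem A))/= -[leLHS]addr0 lerD//; last first.
    by apply: sumr_ge0 => V _; apply: prodr_ge0 => k _; rewrite exprn_ge0// ltW.
  rewrite mulr_natl -sumr_const; apply: ler_sum => V; rewrite inE => VM.
  by rewrite -expr_sum; apply: ler_wiXn2l => //; exact: ltW.
rewrite -(bigA_distr_bigA (fun k (a : 'I_(2 * m).+1) => q ^+ `|(a : nat)%:Z - m%:Z|%N)).
have s0 : 0 <= \sum_(a < (2 * m).+1) q ^+ `|(a : nat)%:Z - m%:Z|%N.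
  by apply: sumr_ge0 => a _; rewrite exprn_ge0// ltW.
have sle := sum_lattice_weight m (ltW q0) q1.
rewrite prodr_const; apply: lerXn2r => //; rewrite nnegrE//.
exact: le_trans sle.
Qed.

(* 10000/81 is ((1 + q) / (1 - q))^2 / q^4 at q = 3/5, and 11/2 is the exponent
   of the Gaussian tail at level sqrt (11 n). *)
Lemma expR_11half {R : realType} : (10000 / 81) * expR (- (11 / 2)) <= 3 / 4 :> R.
Proof.
(* From exp(1/8) >= 1 + 1/8, raised to the fourth power; then (8/5)^11 is a large enough lower bound
   for exp(11/2). *)
have h : (8 / 5 : R) <= expR (2^-1).
  have -> : (2^-1 : R) = 4%:R * 8^-1 by lra.
  rewrite expRM_natl.
  apply: (@le_trans _ _ ((1 + 8^-1) ^+ 4)); first by lra.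
  by rewrite ler_pXn2r ?nnegrE ?expR_ge0// ?expR_ge1Dx//; lra.
have e : (8 / 5 : R) ^+ 11 <= expR (11 / 2).
  by rewrite expRM_natl ler_pXn2r ?nnegrE ?expR_ge0//; lra.
rewrite expRN ler_pdivrMr ?expR_gt0//.
apply: (@le_trans _ _ (3 / 4 * (8 / 5) ^+ 11)); last by rewrite ler_pM2l//; lra.
lra.
Qed.

(** * High-probability bound for the quadratic form *)

Section wigner_events.
Context {R : realType} d (T : measurableType d) (P : probability T R) n
  (g : bool -> 'I_n -> 'I_n -> {RV P >-> R}).
Hypothesis hg : wigner_gaussians g.

Lemma wigner_diag w i : wigner g w i i = 0.
Proof. by rewrite mxE ltnn. Qed.

Lemma cquad_trace (M : 'M[R[i]]_n) u : cquad M u = \tr (u *m cadj u *m M).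
Proof. by rewrite -mulmxA mxtrace_mulC /mxtrace big_ord1. Qed.

(** The variance of u^*Wu is 2 sum_{i<j} |u_i|^2 |u_j|^2, at most |u|^4. The sign [s] selects the
    upper or the lower tail. *)
Lemma wigner_quad_tail (s : bool) (u : 'cV[R[i]]_n) (t : R) : 0 < t -> 0 < nsq u ->
  (P [set w | t * nsq u <= (-1) ^+ s * cre (cquad (wigner g w) u)]%R
    <= (expR (- (t ^+ 2 / 2)))%:E)%E.
Proof.
move=> t0 u0.
pose B := ((-1) ^+ s)%:C%C *: (u *m cadj u).
have hB w : (-1) ^+ s * cre (cquad (wigner g w) u) = cre (\tr (B *m wigner g w)).
  by rewrite -scalemxAl mxtraceZ creM cre_real cim_real mul0r subr0 cquad_trace.
under eq_set do rewrite hB.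
apply: le_trans (wigner_trace_tail (S := nsq u ^+ 2) (t := t * nsq u) hg _ _ _) _.
- by rewrite exprn_gt0.
- by rewrite mulr_gt0.
- pose a i := cabs (u i 0) ^+ 2.
  apply: (@le_trans _ _ (2 * \sum_(i < n) \sum_(j < n | (i < j)%N)
      (a i * a j + a j * a i))).
    rewrite mulr_sumr; apply: ler_sum => i _; rewrite mulr_sumr.
    apply: ler_sum => j ij.
    have -> : B j i + Num.conj (B i j) =
        (2 * (-1) ^+ s)%:C%C * (u j 0 * Num.conj (u i 0)).
      rewrite !mxE !big_ord1 !mxE; apply: complex_eqP;
      rewrite !(creM, cimM, creD, cimD, cre_conj, cim_conj, cre_real, cim_real)/=; ring.
    rewrite !cabsM cabs_conj !exprMn [in X in X <= _]sqr_cabs /= expr0n addr0.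
    rewrite exprMn sqrr_sign mulr1 /a; lra.
  rewrite ler_pM2l//; pose F i j := if i == j then 0 else a i * a j.
  apply: (@le_trans _ _ (\sum_i \sum_j F i j)).
    rewrite sum_offdiag_pair; last by move=> i; rewrite /F eqxx.
    apply: ler_sum => i _; apply: ler_sum => j ij.
    have ij' : (i == j) = false by apply/eqP => e; rewrite e ltnn in ij.
    by rewrite /F [j == i]eq_sym ij'.
  rewrite expr2 /nsq big_distrlr/=; apply: ler_sum => i _; apply: ler_sum => j _.
  by rewrite /F; case: ifP => // _; rewrite mulr_ge0 ?sqr_ge0.
rewrite lee_fin ler_expR lerN2 le_eqVlt; apply/orP; left; apply/eqP.
by field; rewrite gt_eqF.
Qed.

(** At level sqrt(11 n) each tail is exp(-11n/2), and there are at most 2 (10000/81)^n pairs of a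
    sign and a lattice vector, so the total failure is at most 2 (3/4)^n. *)
Lemma wigner_opnorm_event : (0 < n)%N -> exists E : set T, [/\ measurable E,
  (P E >= (1 - 2 * (3 / 4) ^+ n)%:E)%E &
  forall w, E w -> forall u,
    `|cre (cquad (wigner g w) u)| <= Num.sqrt (18 * n%:R) * nsq u].
Proof.
move=> n0; have nR0 : 0 < n%:R :> R by rewrite ltr0n.
pose al : R := Num.sqrt (11 * n%:R).
have al0 : 0 < al by rewrite sqrtr_gt0 mulr_gt0.
have al2 : al ^+ 2 = 11 * n%:R by rewrite sqr_sqrtr// mulr_ge0.
pose VT := {ffun bool * 'I_n -> 'I_(2 * (4 * n)).+1}.
pose v (V : VT) k : int := (V k : nat)%:Z - (4 * n)%:Z.
pose u (V : VT) : 'cV[R[i]]_n := cvec (fun k => (v V k)%:~R).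
pose small (V : VT) := (\sum_k `|v V k| <= 4 * n)%N.
(* The zero vector is left out: its threshold is 0, where no tail bound holds. *)
pose Q (p : bool * VT) := small p.2 && (0 < nsq (u p.2)).
have [||E [mE PE hE]] := @union_bound R _ T P _ Q
  (fun p w => (-1) ^+ p.1 * cre (cquad (wigner g w) (u p.2)))
  (fun p => al * nsq (u p.2)) (fun=> expR (- (al ^+ 2 / 2))).
- move=> p _; apply: measurable_funM => //; under eq_fun do rewrite cquad_trace.
  exact: measurable_wigner_trace.
- by move=> p /andP[_ u0]; exact: wigner_quad_tail.
exists E; split => //.
  apply: le_trans PE; rewrite lee_fin lerB// sumr_const.
  pose A := [pred V : VT | (\sum_k `|(V k : nat)%:Z - (4 * n)%:Z|%N <= 4 * n)%N].
  have cA : #|A|%:R <= (10000 / 81) ^+ n :> R.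
    have q0 : 0 < 3 / 5 :> R by lra.
    have q1 : 3 / 5 < 1 :> R by lra.
    have := @card_lattice_ball R (bool * 'I_n)%type (4 * n) (4 * n) _ q0 q1.
    rewrite card_prod card_bool card_ord -/A !exprM -ler_pdivlMr ?exprn_gt0//.
    rewrite -expr_div_n => /le_trans; apply.
    by rewrite le_eqVlt; apply/orP; left; apply/eqP; congr (_ ^+ _); field.
  have cQ : (#|Q| <= 2 * #|A|)%N.
    have <- : #|[predX {: bool} & A]| = (2 * #|A|)%N by rewrite cardX card_bool.
    apply: subset_leq_card.
    by apply/fintype.subsetP => -[s V] /andP[/= sV _]; rewrite !inE.
  have -> : expR (- (al ^+ 2 / 2)) = expR (- (11 / 2)) ^+ n :> R.
    by rewrite -expRM_natl al2; congr expR; field.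
  rewrite -[leLHS]mulr_natr.
  apply: (@le_trans _ _ (expR (- (11 / 2)) ^+ n * (2 * (10000 / 81) ^+ n))).
    apply: ler_wpM2l; first by rewrite exprn_ge0 ?expR_ge0.
    by apply: (@le_trans _ _ (2 * #|A|)%:R); rewrite ?ler_nat// natrM ler_pM2l.
  rewrite mulrCA -exprMn ler_pM2l// [expR _ * _]mulrC.
  have e0 : 0 <= (10000 / 81) * expR (- (11 / 2)) :> R.
    by apply: mulr_ge0; [lra|exact: expR_ge0].
  have e1 : 0 <= 3 / 4 :> R by lra.
  by apply: lerXn2r; [exact: e0|exact: e1|exact: expR_11half].
move=> w Ew.
have hs (s : bool) x : (-1) ^+ s * cre (cquad (wigner g w) x) <= 5 / 4 * al * nsq x.
  (* Absorbing the sign into the matrix lets the one-sided lattice bound give both signs. *)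
  pose W := ((-1) ^+ s)%:C%C *: wigner g w.
  have WE y : cre (cquad W y) = (-1) ^+ s * cre (cquad (wigner g w) y).
    by rewrite /cquad -scalemxAr -scalemxAl mxE creM cre_real cim_real mul0r subr0.
  rewrite -WE; apply: quad_le_of_lattice => //; first last.
  - move=> z zn.
    have zk k : (`|z k| <= 4 * n)%N.
      by apply: leq_trans zn; rewrite (bigD1 k)//= leq_addr.
    (* Every coordinate of a vector in the l1-ball is at most 4n in absolute value, so the shifted
       ordinals encode it. *)
    pose V : VT := [ffun k => inord `|(z k + (4 * n)%:Z)%R|%N].
    have vz k : v V k = z k.
      rewrite /v ffunE; move: (z k) (zk k) => y hy.
      have hlt : (`|(y + (4 * n)%:Z)%R|%N < (2 * (4 * n)).+1)%N by lia.
      by rewrite inordK//; lia.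
    have uz : u V = cvec (fun k => (z k)%:~R).
      by apply/colP => i; rewrite !mxE !vz.
    rewrite -nsq_cvec -uz WE.
    have [u0|u0] := eqVneq (nsq (u V)) 0.
      by rewrite u0 (nsq_eq0 u0) cquadE /cform mulmx0 mxE !mulr0 lexx.
    apply/ltW/(hE _ Ew (s, V)); rewrite /Q/= lt_def u0 nsq_ge0 !andbT /small.
    by apply: leq_trans zn; apply: leq_sum => k _; rewrite vz.
  - exact: ltW.
  - by move=> i; rewrite mxE wigner_diag mulr0.
move=> x.
(* Here (5/4)^2 * 11 = 275/16, which is below 18. *)
have c54 : 5 / 4 * al <= Num.sqrt (18 * n%:R).
  rewrite -[5 / 4]ger0_norm// -sqrtr_sqr -sqrtrM ?sqr_ge0//.
  by rewrite ler_wsqrtr//; lra.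
apply: (@le_trans _ _ (5 / 4 * al * nsq x)); last by rewrite ler_wpM2r ?nsq_ge0.
rewrite ler_norml; have := hs false x; have := hs true x.
by rewrite expr0 expr1; lra.
Qed.
End wigner_events.

(** * High-probability bound for the entries of Wz *)

Section wigner_entries.
Context {R : realType} d (T : measurableType d) (P : probability T R) n
  (g : bool -> 'I_n -> 'I_n -> {RV P >-> R}).
Hypothesis hg : wigner_gaussians g.
Variable z : 'cV[R[i]]_n.
Hypothesis hz : unimodular z.

(** The rank-one matrix c z e_i^T, chosen so that tr(BW) = c (Wz)_i. *)
Let B (c : R[i]) (i : 'I_n) : 'M[R[i]]_n := \matrix_(k, l) (c * z k 0 * (l == i)%:R).

Let traceB c i w : \tr (B c i *m wigner g w) = c * (wigner g w *m z) i 0.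
Proof.
rewrite mxE mulr_sumr /mxtrace; apply: eq_bigr => k _.
rewrite mxE (bigD1 i)//= big1 ?addr0; last first.
  by move=> l /negbTE li; rewrite mxE li mulr0 mul0r.
by rewrite mxE eqxx mulr1 -mulrA [z k 0 * _]mulrC.
Qed.

Let tailB c i (t : R) : (0 < n)%N -> cabs c = 1 -> 0 < t ->
  (P [set w | t <= cre (c * (wigner g w *m z) i 0)]%R
    <= (expR (- (t ^+ 2 / n%:R)))%:E)%E.
Proof.
move=> n0 c1 t0; have nR0 : 0 < n%:R :> R by rewrite ltr0n.
under eq_set do rewrite -traceB.
apply: le_trans (wigner_trace_tail (S := n%:R / 2) hg _ t0 _) _.
- by rewrite divr_gt0.
(* Each pair containing i has a coefficient of modulus 1 and the other pairs have 0; there are at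
   most n such pairs, so the variance is at most n/2. *)
- pose F (k l : 'I_n) : R := if k == l then 0 else (k == i)%:R.
  apply: (@le_trans _ _ (\sum_k \sum_l F k l)).
    rewrite sum_offdiag_pair; last by move=> k; rewrite /F eqxx.
    apply: ler_sum => k _; apply: ler_sum => l kl.
    have kl' : (k == l) = false by apply/eqP => e; rewrite e ltnn in kl.
    rewrite /F [l == k]eq_sym kl' !mxE.
    have [ki|ki] := eqVneq k i; have [li|li] := eqVneq l i.
    - by rewrite ki li eqxx in kl'.
    - by rewrite mulr1 mulr0 rmorph0 addr0 cabsM c1 hz mulr1 expr1n addr0.
    - by rewrite mulr1 mulr0 add0r cabs_conj cabsM c1 hz mulr1 expr1n add0r.
    - by rewrite !mulr0 rmorph0 addr0 cabs_real ?expr0n ?addr0.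
  apply: (@le_trans _ _ (\sum_(k < n) \sum_(l < n) (k == i)%:R)).
    apply: ler_sum => k _; apply: ler_sum => l _.
    by rewrite /F; case: ifP.
  rewrite exchange_big/= mulrC divfK//.
  have s1 : \sum_(k < n) (k == i)%:R = 1 :> R.
    by rewrite (bigD1 i)//= eqxx big1 ?addr0// => k /negbTE ->.
  by under eq_bigr do rewrite s1; rewrite sumr_const card_ord.
by have -> : 2 * (n%:R / 2) = n%:R :> R by field.
Qed.

Lemma wigner_entries_event : (1 < n)%N -> exists E : set T, [/\ measurable E,
  (P E >= (1 - 4 / n%:R ^+ 2)%:E)%E &
  forall w, E w -> forall i,
    cabs ((wigner g w *m z) i 0) <= Num.sqrt (8 * n%:R * ln n%:R)].
Proof.
move=> n1; have n0 : (0 < n)%N by exact: ltnW.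
have nR1 : 1 < n%:R :> R by rewrite ltr1n.
have nR0 : 0 < n%:R :> R by rewrite ltr0n.
have ln0 : 0 < ln n%:R :> R by exact: ln_gt0.
(* At this level each tail is n^(-4); the 4n events together cost 4 n^(-3), which is at most 4
   n^(-2). *)
pose t : R := Num.sqrt (4 * n%:R * ln n%:R).
have t0 : 0 < t by rewrite sqrtr_gt0 !mulr_gt0.
have t2 : t ^+ 2 = 4 * n%:R * ln n%:R by rewrite sqr_sqrtr// !mulr_ge0// ltW.
(* These four units make Re(c y) run through the values Re y, -Re y, Im y and -Im y; bounding all by
   t gives |y|^2 <= 2 t^2. *)
pose c (s b : bool) : R[i] :=
  if b then Complex ((-1) ^+ s) 0 else Complex 0 (- (-1) ^+ s).
have c1 s b : cabs (c s b) = 1.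
  by rewrite /c /cabs; case: b => /=; rewrite ?sqrrN sqrr_sign expr0n /= ?addr0 ?add0r sqrtr1.
have [||E [mE PE hE]] := @union_bound R _ T P (bool * bool * 'I_n)%type xpredT
  (fun p w => cre (c p.1.1 p.1.2 * (wigner g w *m z) p.2 0))
  (fun=> t) (fun=> expR (- (t ^+ 2 / n%:R))).
- move=> p _; under eq_fun do rewrite -traceB.
  exact: measurable_wigner_trace.
- by move=> p _; exact: tailB.
exists E; split => //.
  apply: le_trans PE; rewrite lee_fin lerB// sumr_const !card_prod card_bool card_ord.
  have -> : expR (- (t ^+ 2 / n%:R)) = (n%:R ^+ 4)^-1 :> R.
    have -> : t ^+ 2 / n%:R = 4%:R * ln n%:R :> R by rewrite t2; field; rewrite gt_eqF.
    by rewrite expRN expRM_natl lnK// posrE.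
  rewrite -[leLHS]mulr_natr [(2 * 2 * n)%:R]natrM.
  have -> : (n%:R ^+ 4)^-1 * ((2 * 2)%:R * n%:R) = 4 / n%:R ^+ 2 / n%:R :> R.
    by field; rewrite gt_eqF.
  rewrite ler_pdivrMr//; apply: ler_peMr; last exact: ltW.
  by rewrite divr_ge0// exprn_ge0.
move=> w Ew i; set y := (wigner g w *m z) i 0.
have hy s b : cre (c s b * y) < t by exact: (hE w Ew (s, b, i) isT).
have sq (x : R) : - x < t -> x < t -> x ^+ 2 <= t ^+ 2.
  move=> x1 x2; rewrite -[x ^+ 2]real_normK ?num_real//.
  by apply: lerXn2r; rewrite ?nnegrE// ?ltW// ltr_norml x2 andbT ltrNl.
rewrite /cabs ler_wsqrtr//.
have := sq (cre y); have := sq (cim y).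
have := hy true true; have := hy false true; have := hy true false; have := hy false false.
rewrite !creM /c /= !expr0 !expr1 => h1 h2 h3 h4 i1 i2.
have r1 : cre y ^+ 2 <= t ^+ 2 by apply: i2; lra.
have r2 : cim y ^+ 2 <= t ^+ 2 by apply: i1; lra.
by rewrite t2 in r1 r2; lra.
Qed.
End wigner_entries.

(** * Optimality conditions and the dual certificate *)

Section operator_norm.
Context {R : rcfType} {n : nat}.
Implicit Types (M : 'M[R[i]]_n) (u v x : 'cV[R[i]]_n).

Definition hdot u v : R[i] := \sum_i Num.conj (u i 0) * v i 0.

Lemma hdotE u v : hdot u v = (cadj u *m v) 0 0.
Proof. by rewrite mxE; apply: eq_bigr => i _; rewrite !mxE. Qed.

Lemma cform_hdot M u v : cform M u v = hdot u (M *m v).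
Proof. by rewrite hdotE /cform mulmxA. Qed.

Lemma hdotDr u v w : hdot u (v + w) = hdot u v + hdot u w.
Proof. by rewrite !hdotE mulmxDr mxE. Qed.

Lemma hdotZr c u v : hdot u (c *: v) = c * hdot u v.
Proof. by rewrite !hdotE -scalemxAr mxE. Qed.

Lemma hdotC u v : hdot v u = Num.conj (hdot u v).
Proof.
rewrite /hdot rmorph_sum; apply: eq_bigr => i _.
by rewrite rmorphM/= conjCK mulrC.
Qed.

Lemma hdot_nsq u : hdot u u = (nsq u)%:C%C.
Proof.
rewrite /nsq rmorph_sum; apply: eq_bigr => i _.
by rewrite rmorphXn/= -norm_cabs normCK mulrC.
Qed.

Lemma nsqD u v : nsq (u + v) = nsq u + nsq v + 2 * cre (hdot u v).
Proof.
rewrite /nsq /hdot cre_sum mulr_sumr -!big_split; apply: eq_bigr => i _ /=.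
by rewrite mxE !sqr_cabs /= !creD !cimD creM cre_conj cim_conj; ring.
Qed.

Lemma nsqN u : nsq (- u) = nsq u.
Proof. by apply: eq_bigr => i _; rewrite mxE cabsN. Qed.

Lemma cform_herm M u v : Defs.hermitian M -> cform M v u = Num.conj (cform M u v).
Proof.
move=> hM; rewrite !cformE exchange_big/= rmorph_sum; apply: eq_bigr => i _.
rewrite rmorph_sum; apply: eq_bigr => j _.
by rewrite !rmorphM/= conjCK -hM [LHS]mulrC [Num.conj _ * M j i]mulrC mulrA.
Qed.

Lemma cre_cform_sym M u v : Defs.hermitian M -> cre (cform M v u) = cre (cform M u v).
Proof. by move=> hM; rewrite cform_herm// cre_conj. Qed.

Lemma cre_quadD M u v (s : R) : Defs.hermitian M ->
  cre (cquad M (u + s%:C%C *: v)) =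
  cre (cquad M u) + 2 * s * cre (cform M u v) + s ^+ 2 * cre (cquad M v).
Proof.
move=> hM; rewrite !cquadE cformDl !cformDr !cformZl !cformZr conjc_real.
have reZ (x : R) c : cre (x%:C%C * c) = x * cre c.
  by rewrite creM cre_real cim_real mul0r subr0.
rewrite !creD !reZ (cre_cform_sym _ _ hM).
have alg (a b c : R) : a + s * b + (s * b + s * (s * c)) =
    a + 2 * s * b + s ^+ 2 * c by ring.
exact: alg.
Qed.

Section bounded.
Variables (M : 'M[R[i]]_n) (w : R).
Hypothesis hM : Defs.hermitian M.
Hypothesis Mw : forall u, `|cre (cquad M u)| <= w * nsq u.

(** Polarization: the bound at u + v and at u - v, combined with the parallelogram identity. *)
Let form_half u v : cre (cform M u v) <= w / 2 * (nsq u + nsq v).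
Proof.
have nD (s : R) : s ^+ 2 = 1 ->
    nsq (u + s%:C%C *: v) = nsq u + nsq v + 2 * (s * cre (hdot u v)).
  move=> s2; rewrite nsqD nsqZ sqr_cabs cre_real cim_real s2 expr0n addr0 mul1r.
  by rewrite hdotZr creM cre_real cim_real mul0r subr0.
have key (s : R) : s ^+ 2 = 1 ->
    `|cre (cquad M u) + 2 * s * cre (cform M u v) + cre (cquad M v)| <=
    w * (nsq u + nsq v + 2 * (s * cre (hdot u v))).
  by move=> s2; have := Mw (u + s%:C%C *: v); rewrite cre_quadD// nD// s2 mul1r.
move: key; move: (cre (cform M u v)) (cre (cquad M u)) (cre (cquad M v)) => p q r.
move: (nsq u) (nsq v) (cre (hdot u v)) => a b c key.
have /ler_normlP[_ h1] := key 1 (expr1n _ _).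
have /ler_normlP[h2 _] : `|q + 2 * -1 * p + r| <= w * (a + b + 2 * (-1 * c)).
  by apply: key; rewrite sqrrN expr1n.
by lra.
Qed.

(** The polarized bound at u and v scaled to unit length. *)
Lemma cre_cform_le u v :
  cre (cform M u v) <= w * (Num.sqrt (nsq u) * Num.sqrt (nsq v)).
Proof.
have [u0|u0] := eqVneq (nsq u) 0.
  by rewrite u0 sqrtr0 mul0r mulr0 (nsq_eq0 u0) -(scale0r 0) cformZl rmorph0 mul0r.
have [v0|v0] := eqVneq (nsq v) 0.
  by rewrite v0 sqrtr0 !mulr0 (nsq_eq0 v0) -(scale0r 0) cformZr mul0r.
have up : 0 < Num.sqrt (nsq u) by rewrite sqrtr_gt0 lt_def u0 nsq_ge0.
have vp : 0 < Num.sqrt (nsq v) by rewrite sqrtr_gt0 lt_def v0 nsq_ge0.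
set a := Num.sqrt (nsq u) in up *; set b := Num.sqrt (nsq v) in vp *.
have a2 : a ^+ 2 = nsq u by rewrite sqr_sqrtr ?nsq_ge0.
have b2 : b ^+ 2 = nsq v by rewrite sqr_sqrtr ?nsq_ge0.
have := form_half ((a^-1)%:C%C *: u) ((b^-1)%:C%C *: v).
rewrite cformZl cformZr conjc_real !creM !cre_real !cim_real !mul0r !subr0.
have ca : cabs (a^-1)%:C%C = a^-1 by rewrite cabs_real// invr_ge0 ltW.
have cb : cabs (b^-1)%:C%C = b^-1 by rewrite cabs_real// invr_ge0 ltW.
have ea : (a^-1) ^+ 2 * nsq u = 1 by rewrite -a2 -exprMn mulVf ?expr1n ?gt_eqF.
have eb : (b^-1) ^+ 2 * nsq v = 1 by rewrite -b2 -exprMn mulVf ?expr1n ?gt_eqF.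
rewrite !nsqZ ca cb ea eb.
have -> : w / 2 * (1 + 1) = w by field.
by rewrite mulrA -invfM ler_pdivrMl ?mulr_gt0// mulrC.
Qed.

(** The bilinear bound at the pair Mu, u, divided by |Mu|. *)
Lemma nsq_mulmx_le u : 0 <= w -> Num.sqrt (nsq (M *m u)) <= w * Num.sqrt (nsq u).
Proof.
move=> w0; have := cre_cform_le (M *m u) u.
rewrite cform_hdot hdot_nsq cre_real.
have [->|p] := eqVneq (nsq (M *m u)) 0; first by move=> _; rewrite sqrtr0 mulr_ge0 ?sqrtr_ge0.
have q : 0 < Num.sqrt (nsq (M *m u)) by rewrite sqrtr_gt0 lt_def p nsq_ge0.
by rewrite -{1}(sqr_sqrtr (nsq_ge0 _)) expr2 mulrCA ler_pM2l.
Qed.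

Lemma cabs_mulmx_le u i : 0 <= w -> cabs ((M *m u) i 0) <= w * Num.sqrt (nsq u).
Proof.
move=> w0; apply: le_trans (nsq_mulmx_le u w0).
rewrite -[leLHS]ger0_norm ?cabs_ge0// -sqrtr_sqr ler_wsqrtr//.
by rewrite /nsq (bigD1 i)//= lerDl sumr_ge0// => j _; rewrite sqr_ge0.
Qed.
End bounded.

(** Cauchy-Schwarz, read off the bilinear bound for the identity matrix after multiplying u by u^*v,
    which makes the form real and equal to |u^*v|^2. *)
Lemma cabs_hdot_le u v : cabs (hdot u v) ^+ 2 <= nsq u * nsq v.
Proof.
have hI : Defs.hermitian (1%:M : 'M[R[i]]_n).
  by move=> i j; rewrite !mxE eq_sym rmorph_nat.
have b1 x : `|cre (cquad 1%:M x)| <= 1 * nsq x.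
  by rewrite cquadE cform_hdot mul1mx hdot_nsq cre_real mul1r ger0_norm ?nsq_ge0.
have := cre_cform_le hI b1 (hdot u v *: u) v.
rewrite cform_herm// cre_conj cform_hdot mul1mx hdotZr mul1r nsqZ.
rewrite [hdot v u]hdotC -normCK norm_cabs -rmorphXn/=.
rewrite sqrtrM ?sqr_ge0// sqrtr_sqr ger0_norm ?cabs_ge0// -mulrA expr2.
have [->|p] := eqVneq (cabs (hdot u v)) 0.
  by move=> _; rewrite mul0r mulr_ge0 ?nsq_ge0.
have q : 0 < cabs (hdot u v) by rewrite lt_def p cabs_ge0.
rewrite ler_pM2l// => h.
rewrite -(sqr_sqrtr (nsq_ge0 u)) -(sqr_sqrtr (nsq_ge0 v)) -exprMn -expr2.
by apply: lerXn2r; rewrite ?nnegrE ?cabs_ge0 ?mulr_ge0 ?sqrtr_ge0.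
Qed.

End operator_norm.

Section psd_factorization.
Local Open Scope sesquilinear_scope.

(** By the spectral theorem, V is the eigenvector matrix with columns scaled by square roots of the
    eigenvalues; each eigenvalue is the form at a unit eigenvector, hence nonnegative. *)
Lemma psd_factor {R : rcfType} n (X : 'M[R[i]]_n) : psd X ->
  exists V : 'M[R[i]]_n, X = V *m cadj V.
Proof.
move=> [hX pX].
have nX : X \is normalmx.
  apply/normalmxP; suff -> : X ^t* = X by [].
  by apply/matrixP => i j; rewrite !mxE hX conjCK.
have /orthomx_spectralP := nX; set Q := spectralmx X; set D := spectral_diag X.
have uQ : Q \is unitarymx by exact: spectral_unitarymx.
rewrite (invmx_unitary uQ) => XE.
have QQ : Q *m Q ^t* = 1%:M by apply/unitarymxP.
have D0 k : 0 <= D 0 k.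
  have := pX (col k (Q ^t*)).
  have -> : cquad X (col k (Q ^t*)) = (Q *m X *m Q ^t*) k k.
    rewrite cquadE cformE -mulmxA mxE; apply: eq_bigr => i _.
    rewrite !mxE mulr_sumr; apply: eq_bigr => j _.
    by rewrite !mxE conjCK mulrA.
  by rewrite {1}XE !mulmxA QQ mul1mx -mulmxA QQ mulmx1 mxE eqxx mulr1n.
exists (Q ^t* *m diag_mx (map_mx sqrtC D)).
have cE m p (A : 'M[R[i]]_(m, p)) : cadj A = A ^t* by apply/matrixP => i j; rewrite !mxE.
rewrite cE trmx_mul map_mxM/= trmxCK tr_diag_mx map_diag_mx.
rewrite mulmxA -[_ *m diag_mx _ *m diag_mx _]mulmxA mulmx_diag [LHS]XE.
congr (_ *m diag_mx _ *m _); apply/rowP => k; rewrite !mxE.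
have s0 : 0 <= sqrtC (D 0 k) by rewrite sqrtC_ge0.
by rewrite /= (CrealP (ger0_real s0)) -expr2 sqrtCK.
Qed.

End psd_factorization.

(** * First-order optimality and dual certificates *)

Section unimodular_vectors.
Context {R : rcfType} {n : nat}.
Implicit Types (M : 'M[R[i]]_n) (u v x z : 'cV[R[i]]_n).

Lemma nsq_unimodular x : unimodular x -> nsq x = n%:R.
Proof.
move=> hx; rewrite /nsq; under eq_bigr do rewrite hx expr1n.
by rewrite sumr_const card_ord.
Qed.

Lemma hdotNr u v : hdot u (- v) = - hdot u v.
Proof. by rewrite !hdotE mulmxN mxE. Qed.

Lemma hdotBr u v w : hdot u (v - w) = hdot u v - hdot u w.
Proof. by rewrite hdotDr hdotNr. Qed.

Lemma hdot_delta i v : hdot (delta_mx i 0) v = v i 0.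
Proof.
rewrite /hdot (bigD1 i)//= big1 ?addr0; last first.
  by move=> j /negbTE ji; rewrite mxE ji conjC0 mul0r.
by rewrite mxE !eqxx conjC1 mul1r.
Qed.

Lemma cre_hdotC u v : cre (hdot v u) = cre (hdot u v).
Proof. by rewrite hdotC cre_conj. Qed.

(** Replacing x_i by a unit c changes the objective by 2 Re(conj(c - x_i) b) with b = (Mx)_i - x_i,
    because M_ii = 1. Hence x_i is the direction of b when b is nonzero, and mu = |b| + 1. *)
Lemma coord_opt M x i : Defs.hermitian M -> M i i = 1 -> phase_sync_opt M x ->
  exists2 mu : R, 1 <= mu & (M *m x) i 0 = mu%:C%C * x i 0.
Proof.
move=> hM Mii [ux hx]; set m := (M *m x) i 0; pose b := m - x i 0.
have xx : cre (x i 0) ^+ 2 + cim (x i 0) ^+ 2 = 1.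
  by rewrite -sqr_cabs ux expr1n.
have opt c : cabs c = 1 ->
    cre c * cre b + cim c * cim b <= cre (x i 0) * cre b + cim (x i 0) * cim b.
  move=> c1; have cc : cre c ^+ 2 + cim c ^+ 2 = 1 by rewrite -sqr_cabs c1 expr1n.
  pose e : 'cV[R[i]]_n := (c - x i 0) *: delta_mx i 0.
  have uy : unimodular (x + 1%:C%C *: e).
    move=> j; rewrite !mxE; have [->|ji] := eqVneq j i.
      by rewrite !eqxx mulr1 mul1r addrC subrK.
    by rewrite andFb !mulr0 addr0 ux.
  have := hx _ uy; rewrite cre_quadD// -addrA gerDl => h.
  have ex : cre (cform M x e) = cre (Num.conj (c - x i 0) * m).
    by rewrite -(cre_cform_sym _ _ hM) cformZl cform_hdot hdot_delta.
  have ee : cre (cquad M e) = cre (Num.conj (c - x i 0) * (c - x i 0)).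
    rewrite cquadE cformZl cformZr cform_hdot hdot_delta.
    by rewrite -colE mxE Mii mulr1.
  move: h; rewrite ex ee (_ : m = b + x i 0); last by rewrite subrK.
  rewrite !creM !cre_conj !cim_conj !creD !cimD !creN !cimN.
  move: (cre c) (cim c) (cre b) (cim b) (cre (x i 0)) (cim (x i 0)) cc xx.
  by move=> c1' c2 b1 b2 x1 x2 cc xx; lra.
exists (cabs b + 1); first by rewrite lerDr cabs_ge0.
suff bE : b = (cabs b)%:C%C * x i 0.
  by rewrite rmorphD/= mulrDl -bE mul1r subrK.
have b2 := sqr_cabs b.
(* The test value c = b / |b| forces equality in Cauchy-Schwarz between b and x_i. *)
have le : cabs b <= cre (x i 0) * cre b + cim (x i 0) * cim b.
  have [b0|b0] := eqVneq (cabs b) 0.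
    move: b2; rewrite b0 expr0n/= => /esym/eqP.
    rewrite paddr_eq0 ?sqr_ge0// !sqrf_eq0 => /andP[/eqP -> /eqP ->].
    by rewrite !mulr0 addr0.
  have c1 : cabs (((cabs b)^-1)%:C%C * b) = 1.
    by rewrite cabsM cabs_real ?invr_ge0 ?cabs_ge0// mulVf.
  have := opt _ c1; rewrite creM cimM cre_real cim_real !mul0r subr0 addr0.
  by rewrite -!mulrA -mulrDr -!expr2 -b2 expr2 mulKf.
have B0 := cabs_ge0 b.
have sq0 : (cre b - cabs b * cre (x i 0)) ^+ 2 +
    (cim b - cabs b * cim (x i 0)) ^+ 2 <= 0.
  move: (cre b) (cim b) (cre (x i 0)) (cim (x i 0)) (cabs b) xx b2 le B0.
  move=> b1 b2' x1 x2 B xx b2 le B0.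
  have -> : (b1 - B * x1) ^+ 2 + (b2' - B * x2) ^+ 2 =
    (b1 ^+ 2 + b2' ^+ 2) - 2 * B * (x1 * b1 + x2 * b2') +
    B ^+ 2 * (x1 ^+ 2 + x2 ^+ 2) by ring.
  rewrite xx -b2; have := ler_wpM2l B0 le; lra.
have {sq0} : (cre b - cabs b * cre (x i 0)) ^+ 2 +
    (cim b - cabs b * cim (x i 0)) ^+ 2 == 0.
  by rewrite eq_le sq0 addr_ge0 ?sqr_ge0.
rewrite paddr_eq0 ?sqr_ge0// !sqrf_eq0 !subr_eq0 => /andP[/eqP h1 /eqP h2].
by apply: complex_eqP; rewrite ?creM ?cimM cre_real cim_real mul0r ?subr0 ?addr0.
Qed.

Lemma quad_sum_diag M m (V : 'M[R[i]]_(n, m)) :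
  sdp_obj M (V *m cadj V) = \sum_k cre (cquad M (col k V)).
Proof.
rewrite /sdp_obj mulmxA mxtrace_mulC /mxtrace cre_sum; apply: eq_bigr => k _.
rewrite cquadE cformE mxE; congr cre; apply: eq_bigr => i _.
rewrite !mxE mulr_sumr; apply: eq_bigr => j _.
by rewrite !mxE mulrA.
Qed.

Lemma diag_mul_cadj m (V : 'M[R[i]]_(n, m)) i :
  (V *m cadj V) i i = (\sum_k cabs (V i k) ^+ 2)%:C%C.
Proof.
rewrite mxE rmorph_sum; apply: eq_bigr => k _.
by rewrite !mxE rmorphXn/= -norm_cabs normCK.
Qed.

Lemma psd_mul_cadj m (V : 'M[R[i]]_(n, m)) : psd (V *m cadj V).
Proof.
split.
  move=> i j; rewrite !mxE rmorph_sum; apply: eq_bigr => k _.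
  by rewrite !mxE rmorphM/= conjCK mulrC.
move=> u; have -> : cquad (V *m cadj V) u =
    \sum_k (cadj u *m V) 0 k * Num.conj ((cadj u *m V) 0 k).
  rewrite /cquad !mulmxA -mulmxA mxE; apply: eq_bigr => k _; congr (_ * _).
  rewrite !mxE rmorph_sum; apply: eq_bigr => i _.
  by rewrite !mxE rmorphM/= conjCK mulrC.
by apply: sumr_ge0 => k _; exact: mul_conjC_ge0.
Qed.

(** The matrix S = diag(mu) - M kills x and is positive definite on its orthogonal complement. Since
    tr(MY) = sum mu_i - tr(SY) for feasible Y, the optimum is sum mu_i, and it is attained only if
    tr(SY) = 0. *)
Lemma sdp_unique_of_certificate M x (mu : 'I_n -> R) (gam : R) :
  Defs.hermitian M -> (0 < n)%N -> unimodular x ->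
  (forall i, (M *m x) i 0 = (mu i)%:C%C * x i 0) -> 0 < gam ->
  (forall u, hdot x u = 0 ->
    gam * nsq u <= \sum_i mu i * cabs (u i 0) ^+ 2 - cre (cquad M u)) ->
  sdp_unique_solution M (x *m cadj x).
Proof.
move=> hM n0 ux hmu gam0 hgam.
pose qS u := \sum_i mu i * cabs (u i 0) ^+ 2 - cre (cquad M u).
pose S : 'M[R[i]]_n := diag_mx (\row_i (mu i)%:C%C) - M.
have hS : Defs.hermitian S.
  move=> i j; rewrite !mxE hM eq_sym rmorphB/= rmorphMn/= conjc_real.
  by case: eqP => [->|] //; rewrite !mulr0n.
have SE u : cre (cquad S u) = qS u.
  rewrite /qS cquadE cform_hdot mulmxBl hdotBr creD creN -(cform_hdot M u u) -cquadE.
  congr (_ - _); rewrite /hdot cre_sum; apply: eq_bigr => i _.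
  rewrite mul_diag_mx !mxE mulrCA [Num.conj _ * _]mulrC -normCK norm_cabs.
  by rewrite -rmorphXn -rmorphM.
have Sx : S *m x = 0.
  apply/colP => i; rewrite mulmxBl mxE [(- (M *m x)) i 0]mxE hmu mul_diag_mx.
  by rewrite !mxE subrr.
have nx : nsq x = n%:R by exact: nsq_unimodular.
have nR0 : 0 < n%:R :> R by rewrite ltr0n.
(* Here [p v] is the orthogonal projection off x; as Sx = 0, v and [p v] have the same value of
   [qS]. *)
pose c v := hdot x v / (n%:R)%:C%C; pose p v := v - c v *: x.
have hp v : hdot x (p v) = 0.
  rewrite hdotBr hdotZr hdot_nsq nx /c divfK ?subrr//.
  by apply/eqP => /(congr1 cre); rewrite cre_real => /eqP; rewrite gt_eqF.
have qS_dec u a : qS (u + a *: x) = qS u.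
  rewrite -!SE !cquadE cformDl !cformDr !cformZl !cformZr.
  have Fx v : cform S v x = 0 by rewrite cform_hdot Sx /hdot big1// => i _; rewrite mxE mulr0.
  have Fx' v : cform S x v = 0 by rewrite (cform_herm v x hS) Fx conjC0.
  by rewrite !Fx !Fx' !mulr0 !addr0.
have qS_ge v : gam * nsq (p v) <= qS v.
  by rewrite -[in leRHS](subrK (c v *: x) v) qS_dec hgam.
have qS_ge0 v : 0 <= qS v.
  by apply: le_trans (qS_ge v); rewrite mulr_ge0 ?nsq_ge0// ltW.
have objE m (V : 'M[R[i]]_(n, m)) : (forall i, (V *m cadj V) i i = 1) ->
    sdp_obj M (V *m cadj V) = \sum_i mu i - \sum_k qS (col k V).
  move=> V1; rewrite quad_sum_diag.
  have -> : \sum_i mu i = \sum_k \sum_i mu i * cabs (col k V i 0) ^+ 2.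
    rewrite exchange_big/=; apply: eq_bigr => i _; rewrite -mulr_sumr.
    have := V1 i; rewrite diag_mul_cadj => /(congr1 cre); rewrite cre_real => e.
    by under eq_bigr do rewrite mxE; rewrite e mulr1.
  by rewrite -sumrB; apply: eq_bigr => k _; rewrite /qS opprB addrC subrK.
have x1 i : (x *m cadj x) i i = 1.
  by rewrite diag_mul_cadj big_ord1 ux expr1n.
have objx : sdp_obj M (x *m cadj x) = \sum_i mu i.
  rewrite objE// big_ord1 (_ : col 0 x = x); last by apply/colP => i; rewrite mxE.
  by rewrite -SE cquadE cform_hdot Sx hdotE mulmx0 mxE subr0.
split.
  split; first by split => //; exact: psd_mul_cadj.
  move=> Y [Y1 /psd_factor[V YV]]; rewrite objx YV objE -?YV//.
  by rewrite gerBl sumr_ge0.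
move=> X [[X1 /psd_factor[V XV]] optX].
have V1 i : (V *m cadj V) i i = 1 by rewrite -XV.
have fx : sdp_feasible (x *m cadj x) by split => //; exact: psd_mul_cadj.
have := optX _ fx; rewrite objx XV objE// lerBrDl gerDr => hq.
have q0 k : qS (col k V) = 0.
  have : \sum_k qS (col k V) == 0 by rewrite eq_le hq sumr_ge0.
  by rewrite psumr_eq0// => /allP/(_ k (mem_index_enum _))/eqP.
have pk k : p (col k V) = 0.
  apply: nsq_eq0; apply/eqP; rewrite eq_le nsq_ge0 andbT.
  by have := qS_ge (col k V); rewrite q0 pmulr_rle0.
pose a : 'rV[R[i]]_n := \row_k c (col k V).
have Va : V = x *m a.
  apply/matrixP => i k; rewrite mxE big_ord1 mxE mulrC.
  have := pk k; rewrite /p => /eqP; rewrite subr_eq0 => /eqP/colP/(_ i).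
  by rewrite !mxE.
have VE : V *m cadj V = x *m (a *m cadj a) *m cadj x.
  have -> : cadj V = cadj a *m cadj x by rewrite Va /cadj map_mxM trmx_mul.
  by rewrite Va !mulmxA.
have i0 : 'I_n by exact: Ordinal n0.
rewrite VE; suff -> : a *m cadj a = 1%:M by rewrite mulmx1.
rewrite [LHS]mx11_scalar; congr (_%:M).
have := V1 i0; rewrite VE [X in x *m X]mx11_scalar mul_mx_scalar -scalemxAl mxE x1.
by rewrite mulr1.
Qed.
End unimodular_vectors.

(** * Optimizers of the synchronization problem for a fixed noise matrix *)

Section synchronization.
Context {R : rcfType} {n : nat}.
Variables (z x : 'cV[R[i]]_n) (W : 'M[R[i]]_n) (sigma lam w : R).
Hypothesis n0 : (0 < n)%N.
Hypothesis uz : unimodular z.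
Hypothesis hW : Defs.hermitian W.
Hypothesis W0 : forall i, W i i = 0.
Hypothesis Ww : forall u, `|cre (cquad W u)| <= w * nsq u.
Hypothesis w0 : 0 <= w.
Hypothesis s0 : 0 <= sigma.
Let C : 'M[R[i]]_n := z *m cadj z + (sigma%:C)%C *: W.
Hypothesis hx : phase_sync_opt C x.
Hypothesis hlam : hdot z x = lam%:C%C.
Hypothesis lam0 : 0 <= lam.

Lemma sync_mulmx v : C *m v = hdot z v *: z + sigma%:C%C *: (W *m v).
Proof.
rewrite mulmxDl -mulmxA -scalemxAl; congr (_ + _).
by rewrite [cadj z *m v]mx11_scalar mul_mx_scalar hdotE.
Qed.

Lemma sync_hermitian : Defs.hermitian C.
Proof.
move=> i j; rewrite !mxE !big_ord1 !mxE hW rmorphD/= !rmorphM/= conjc_real conjCK.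
by rewrite mulrC.
Qed.

Lemma sync_diag i : C i i = 1.
Proof.
by rewrite !mxE big_ord1 !mxE W0 mulr0 addr0 -normCK norm_cabs uz expr1n.
Qed.

Lemma sync_quad u :
  cre (cquad C u) = cabs (hdot z u) ^+ 2 + sigma * cre (cquad W u).
Proof.
rewrite cquadE cform_hdot sync_mulmx hdotDr !hdotZr creD [hdot u z]hdotC.
rewrite -normCK norm_cabs -rmorphXn/= -cform_hdot -cquadE; congr (_ + _).
by rewrite creM cre_real cim_real mul0r subr0.
Qed.

Let ux : unimodular x. Proof. by case: hx. Qed.
Let nR0 : 0 < n%:R :> R. Proof. by rewrite ltr0n. Qed.

Lemma nsq_sub : nsq (x - z) = 2 * n%:R - 2 * lam.
Proof.
rewrite nsqD nsqN !nsq_unimodular// hdotNr creN cre_hdotC hlam cre_real.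
by ring.
Qed.

(* |x - z|^2 |x + z|^2 = 4 (n^2 - lam^2), and optimality bounds n^2 - lam^2 by
   sigma Re (x - z)^* W (x + z). *)
Lemma sync_l2 : n%:R * nsq (x - z) <= 8 * sigma ^+ 2 * w ^+ 2.
Proof.
have sp : nsq (x + z) = 2 * n%:R + 2 * lam.
  by rewrite nsqD !nsq_unimodular// cre_hdotC hlam cre_real; ring.
have := hx.2 z uz; rewrite !sync_quad hlam hdot_nsq !cabs_real ?nsq_ge0//.
rewrite nsq_unimodular// => opt.
have qq : cre (cform W (x - z) (x + z)) = cre (cquad W x) - cre (cquad W z).
  have Nl v : cform W (- z) v = - cform W z v.
    by rewrite -scaleN1r cformZl rmorphN1 mulN1r.
  rewrite cformDl !cformDr !Nl -!cquadE !creD !creN (cre_cform_sym x z hW).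
  have alg (a b c : R) : a + c + (- c - b) = a - b by ring.
  exact: alg.
have := cre_cform_le hW Ww (x - z) (x + z); rewrite qq.
have a2 := sqr_sqrtr (nsq_ge0 (x - z)); have b2 := sqr_sqrtr (nsq_ge0 (x + z)).
have a0 := sqrtr_ge0 (nsq (x - z)); have b0 := sqrtr_ge0 (nsq (x + z)).
move=> pq; rewrite -a2; move: pq a2 b2 a0 b0.
set a := Num.sqrt (nsq (x - z)); set b := Num.sqrt (nsq (x + z)).
rewrite nsq_sub sp => pq a2 b2 a0 b0.
move: a b (cre (cquad W x)) (cre (cquad W z)) a2 b2 a0 b0 pq opt => a b p q.
move=> a2 b2 a0 b0 pq opt.
have [->|a1] := eqVneq a 0; first by rewrite expr0n mulr0 !mulr_ge0 ?sqr_ge0.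
have ap : 0 < a by rewrite lt_def a1.
(* Optimality reads n^2 - lam^2 <= sigma (q(x) - q(z)), and a^2 b^2 = 4 (n^2 - lam^2). *)
have h1 : a ^+ 2 * b ^+ 2 <= 4 * (sigma * w) * (a * b).
  have := ler_wpM2l s0 pq; rewrite a2 b2; lra.
have bp : 0 < b.
  rewrite lt_def b0 andbT; apply/eqP => b00; move: b2; rewrite b00 expr0n/=.
  by have := nR0; have := lam0; lra.
have h2 : a * b <= 4 * (sigma * w).
  have abp : 0 < a * b by rewrite mulr_gt0.
  by rewrite -(ler_pM2r abp); apply: le_trans h1; rewrite -expr2 exprMn.
have h3 : (a * b) ^+ 2 <= (4 * (sigma * w)) ^+ 2.
  by apply: lerXn2r; rewrite ?nnegrE// !mulr_ge0.
(* The phase convention lam >= 0 gives |x + z|^2 >= 2n. *)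
have h4 : a ^+ 2 * (2 * n%:R) <= a ^+ 2 * b ^+ 2.
  by rewrite ler_wpM2l ?sqr_ge0// b2 lerDl mulr_ge0.
move: h3; rewrite !exprMn; lra.
Qed.

(** Taking moduli in mu x_i = lam z_i + sigma (Wx)_i bounds |mu - lam|. *)
Lemma sync_multiplier i : exists2 mu : R, 1 <= mu &
  (C *m x) i 0 = mu%:C%C * x i 0 /\
  `|mu - lam| <= sigma * cabs ((W *m x) i 0).
Proof.
have [mu mu1 muE] := coord_opt sync_hermitian (sync_diag i) hx.
exists mu => //; split => //.
have e : mu%:C%C * x i 0 = lam%:C%C * z i 0 + sigma%:C%C * (W *m x) i 0.
  by rewrite -muE sync_mulmx hlam !mxE.
have cmu : cabs (mu%:C%C * x i 0) = mu.
  by rewrite cabsM ux mulr1 cabs_real// (le_trans _ mu1).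
have clam : cabs (lam%:C%C * z i 0) = lam by rewrite cabsM uz mulr1 cabs_real.
have cs : cabs (sigma%:C%C * (W *m x) i 0) = sigma * cabs ((W *m x) i 0).
  by rewrite cabsM cabs_real.
have e' : lam%:C%C * z i 0 = mu%:C%C * x i 0 + (- (sigma%:C%C * (W *m x) i 0)).
  by rewrite e addrK.
rewrite ler_norml; apply/andP; split.
  have := cabsD (mu%:C%C * x i 0) (- (sigma%:C%C * (W *m x) i 0)).
  by rewrite -e' cabsN cs cmu clam; lra.
have := cabsD (lam%:C%C * z i 0) (sigma%:C%C * (W *m x) i 0).
by rewrite -e cs cmu clam; lra.
Qed.

(** From lam (x_i - z_i) = (lam - mu) x_i + sigma (Wx)_i; both terms on the right are at most sigma
    |(Wx)_i|. *)
Lemma sync_entry i :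
  lam * cabs (x i 0 - z i 0) <= 2 * sigma * cabs ((W *m x) i 0).
Proof.
have [mu mu1 [muE mul]] := sync_multiplier i.
have e : lam%:C%C * (x i 0 - z i 0) =
    (lam - mu)%:C%C * x i 0 + sigma%:C%C * (W *m x) i 0.
  have : mu%:C%C * x i 0 = lam%:C%C * z i 0 + sigma%:C%C * (W *m x) i 0.
    by rewrite -muE sync_mulmx hlam !mxE.
  by rewrite rmorphB/= mulrBl => ->; rewrite mulrBr; ring.
rewrite -[X in X * _](cabs_real lam0) -cabsM e; apply: (le_trans (cabsD _ _)).
rewrite !cabsM ux mulr1 (cabs_real s0).
have -> : cabs (lam - mu)%:C%C = `|mu - lam|.
  by rewrite /cabs /= expr0n addr0 sqrtr_sqr distrC.
by apply: (le_trans (lerD mul (lexx _))); lra.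
Qed.

(** For u orthogonal to x, |z^*u| = |(x - z)^*u| <= |x - z| |u|, so the large rank-one part of C
    costs only |x - z|^2. The remaining losses are the deviation of mu from lam and sigma w. *)
Lemma sync_sdp (e : R) : (forall i, cabs ((W *m x) i 0) <= e) ->
  0 < lam - sigma * e - nsq (x - z) - sigma * w ->
  sdp_unique_solution C (x *m cadj x).
Proof.
move=> he; set gam := (X in 0 < X) => gam0.
have /choice[mu hmu] : forall i, exists mu : R,
    (C *m x) i 0 = mu%:C%C * x i 0 /\ lam - sigma * e <= mu.
  move=> i; have [mu _ [muE]] := sync_multiplier i.
  rewrite ler_norml => /andP[h _]; exists mu; split => //.
  by have := ler_wpM2l s0 (he i); lra.
apply: (sdp_unique_of_certificate sync_hermitian n0 ux (fun i => (hmu i).1) gam0).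
move=> u xu; rewrite sync_quad.
have h1 : (lam - sigma * e) * nsq u <= \sum_i mu i * cabs (u i 0) ^+ 2.
  rewrite mulr_sumr; apply: ler_sum => i _.
  by rewrite ler_wpM2r ?sqr_ge0//; case: (hmu i).
have h2 : cabs (hdot z u) ^+ 2 <= nsq (x - z) * nsq u.
  have <- : cabs (hdot (x - z) u) = cabs (hdot z u).
    rewrite hdotC cabs_conj hdotBr [hdot u x]hdotC xu conjC0 sub0r cabsN.
    by rewrite hdotC cabs_conj.
  exact: cabs_hdot_le.
have h3 : sigma * cre (cquad W u) <= sigma * (w * nsq u).
  by rewrite ler_wpM2l// (le_trans (ler_norm _)).
by rewrite /gam; lra.
Qed.
End synchronization.

(** * Numerical estimates on the good event *)

(** The shift by 7 makes (n + 7)^2 (3/4)^n decreasing from n = 0 on, since (8/7)^2 < 4/3. *)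
Lemma expr_three_quarters_le {R : realFieldType} (n : nat) :
  n%:R ^+ 2 * (3 / 4) ^+ n <= 49 :> R.
Proof.
suff h : (n%:R + 7) ^+ 2 * (3 / 4) ^+ n <= 49 :> R.
  apply: le_trans h; rewrite ler_wpM2r ?exprn_ge0 ?divr_ge0//.
  by rewrite lerXn2r ?nnegrE ?addr_ge0// lerDl.
elim: n => [|n IHn]; first by rewrite add0r expr0 mulr1; lra.
apply: le_trans IHn; rewrite [(3 / 4) ^+ n.+1]exprS mulrA ler_wpM2r ?exprn_ge0 ?divr_ge0//.
rewrite -natr1; have : 0 <= n%:R :> R by []; move: (n%:R : R) => m m0.
by have := sqr_ge0 m; lra.
Qed.

(** From log y <= y - 1 and 4y <= y^2. With y = n^(1/4) it bounds sqrt(log n) by n^(1/4). *)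
Lemma ln_pow4_le {R : realType} (y : R) : 4 <= y -> ln (y ^+ 4) <= y ^+ 2.
Proof.
move=> y4; have y0 : 0 < y by lra.
rewrite lnXn// -[leLHS]mulr_natr.
have : ln (1 + (y - 1)) <= y - 1 by apply: le_ln1Dx; lra.
rewrite addrC subrK => h.
have : 4 * y <= y * y by rewrite ler_pM2r.
by rewrite expr2; lra.
Qed.

Section deterministic.
Context {R : realType} {n : nat}.
Variables (z x : 'cV[R[i]]_n) (W : 'M[R[i]]_n) (sigma : R).
Hypothesis n4 : (10 ^ 4 <= n)%N.
Hypothesis uz : unimodular z.
Hypothesis hW : Defs.hermitian W.
Hypothesis W0 : forall i, W i i = 0.
Hypothesis Ww : forall u, `|cre (cquad W u)| <= Num.sqrt (18 * n%:R) * nsq u.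
Hypothesis Wz : forall i, cabs ((W *m z) i 0) <= Num.sqrt (8 * n%:R * ln n%:R).
Hypothesis s0 : 0 <= sigma.
Let C : 'M[R[i]]_n := z *m cadj z + (sigma%:C)%C *: W.
Hypothesis hx : phase_sync_opt C x.
Hypothesis hphase : (cadj z *m x) 0 0 = `|(cadj z *m x) 0 0|.

Lemma sync_deterministic :
  (forall i, cabs (x i 0 - z i 0) <=
    6 * (Num.sqrt (ln (n%:R : R)) + 29 * sigma) * sigma / Num.sqrt (n%:R)) /\
  Num.sqrt (\sum_i cabs (x i 0 - z i 0) ^+ 2) <= 12 * sigma /\
  (sigma <= 18^-1 * n%:R `^ (1 / 4) -> sdp_unique_solution C (x *m cadj x)).
Proof.
have n0 : (0 < n)%N by apply: leq_trans n4.
pose lam := cabs (hdot z x).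
have hlam : hdot z x = lam%:C%C by rewrite hdotE hphase -hdotE norm_cabs.
have lam0 : 0 <= lam by exact: cabs_ge0.
pose w : R := Num.sqrt (18 * n%:R).
have w0 : 0 <= w by exact: sqrtr_ge0.
have w2 : w ^+ 2 = 18 * n%:R by rewrite sqr_sqrtr// mulr_ge0.
pose r : R := Num.sqrt n%:R; pose y := Num.sqrt r; pose L : R := Num.sqrt (ln n%:R).
have r0 : 0 <= r by exact: sqrtr_ge0.
have y0 : 0 <= y by exact: sqrtr_ge0.
have L0 : 0 <= L by exact: sqrtr_ge0.
have r2 : r ^+ 2 = n%:R by rewrite sqr_sqrtr.
have y2 : y ^+ 2 = r by rewrite sqr_sqrtr.
have r100 : 100 <= r.
  rewrite -[leLHS]ger0_norm// -sqrtr_sqr ler_wsqrtr//.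
  by apply: (@le_trans _ _ (10 ^ 4)%:R); rewrite ?ler_nat// natrX; lra.
have y10 : 10 <= y.
  by rewrite -[leLHS]ger0_norm// -sqrtr_sqr ler_wsqrtr//; lra.
have lnn : 0 <= ln n%:R :> R by rewrite ln_ge0// ler1n.
have L2 : L ^+ 2 = ln n%:R by rewrite sqr_sqrtr.
have Ly : L <= y.
  rewrite -[y]ger0_norm// -sqrtr_sqr ler_wsqrtr//.
  have -> : n%:R = y ^+ 4 :> R by rewrite -r2 -y2 -exprM.
  by apply: ln_pow4_le; lra.
have wr : w <= 17 / 4 * r.
  rewrite /w sqrtrM// ler_wpM2r// -[leRHS]ger0_norm// -sqrtr_sqr ler_wsqrtr//; lra.
have s8 : Num.sqrt 8 <= 283 / 100 :> R.
  have c0 : 0 <= 283 / 100 :> R by lra.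
  by rewrite -(ger0_norm c0) -sqrtr_sqr ler_wsqrtr// expr2; lra.
have Wzr i : cabs ((W *m z) i 0) <= 283 / 100 * r * L.
  apply: (le_trans (Wz i)); rewrite -mulrA sqrtrM// sqrtrM// -mulrA.
  by apply: ler_wpM2r; [exact: mulr_ge0|exact: s8].
have del2 : nsq (x - z) <= 144 * sigma ^+ 2.
  have := sync_l2 n0 uz hW Ww w0 s0 hx hlam lam0; rewrite -/w w2.
  have nR : 0 < n%:R :> R by rewrite ltr0n.
  have -> : 8 * sigma ^+ 2 * (18 * n%:R) = n%:R * (144 * sigma ^+ 2) by ring.
  by rewrite ler_pM2l.
have del : Num.sqrt (nsq (x - z)) <= 12 * sigma.
  have -> : 12 * sigma = Num.sqrt (144 * sigma ^+ 2).
    have -> : 144 * sigma ^+ 2 = (12 * sigma) ^+ 2 by ring.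
    by rewrite sqrtr_sqr ger0_norm// mulr_ge0.
  exact: ler_wsqrtr.
(* The first term bounds (Wz)_i; the second is (17/4) r * 12 sigma, a bound for |W(x - z)|. *)
pose e := r * (283 / 100 * L + 51 * sigma).
have he i : cabs ((W *m x) i 0) <= e.
  have -> : W *m x = W *m z + W *m (x - z) by rewrite -mulmxDr addrC subrK.
  rewrite mxE; apply: (le_trans (cabsD _ _)).
  have h1 := Wzr i; have h2 := cabs_mulmx_le hW Ww (x - z) i w0.
  have h3 : w * Num.sqrt (nsq (x - z)) <= 17 / 4 * r * (12 * sigma).
    by apply: ler_pM => //; exact: sqrtr_ge0.
  apply: (le_trans (lerD h1 (le_trans h2 h3))).
  by rewrite /e; lra.
have hl : lam = n%:R - nsq (x - z) / 2.
  by rewrite (nsq_sub uz hx hlam); lra.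
have sL0 : 0 <= sigma * L by rewrite mulr_ge0.
have ss0 : 0 <= sigma ^+ 2 by rewrite sqr_ge0.
split; [|split].
- move=> i; have r00 : 0 < r by lra.
  rewrite -/r -/L ler_pdivlMr//.
  (* For r <= 87 sigma^2 the claimed bound is at least 6 * 29 / 87 = 2, the largest distance of two
     unit numbers. *)
  have [big|small] := leP r (87 * sigma ^+ 2).
    have d2 : cabs (x i 0 - z i 0) <= 2.
      apply: (le_trans (cabsD _ _)); rewrite cabsN uz hx.1; lra.
    apply: (@le_trans _ _ (2 * r)); first by rewrite ler_wpM2r.
    by rewrite expr2 in big; lra.
  have := sync_entry uz hW W0 s0 hx hlam lam0 i.
  have d0 := cabs_ge0 (x i 0 - z i 0).
  set D := cabs _ in d0 *.
  move=> h.
  (* Otherwise n - lam = |x - z|^2 / 2 <= 72 sigma^2 < r, and r is at most n / 100. *)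
  have h1 : 99 / 100 * r ^+ 2 <= lam.
    have : r * 100 <= r * r by rewrite ler_wpM2l.
    by rewrite hl r2 -r2 expr2; lra.
  have h2 : 99 / 100 * r ^+ 2 * D <= 2 * sigma * e.
    apply: (le_trans (ler_wpM2r d0 h1)); apply: (le_trans h).
    by apply: ler_wpM2l => //; rewrite mulr_ge0.
  (* The slack: 2 * 2.83 / 0.99 < 6 and 2 * 51 / 0.99 < 6 * 29. *)
  have h3 : r * (D * r) <= r * (6 * (L + 29 * sigma) * sigma).
    have : 0 <= r * (sigma * L) by rewrite mulr_ge0.
    have : 0 <= r * sigma ^+ 2 by rewrite mulr_ge0.
    move: h2; rewrite /e !expr2; lra.
  by move: h3; rewrite ler_pM2l.
- have -> : \sum_i cabs (x i 0 - z i 0) ^+ 2 = nsq (x - z).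
    by apply: eq_bigr => i _; rewrite !mxE.
  exact: del.
move=> sy.
have yE : n%:R `^ (1 / 4) = y.
  have -> : n%:R = y `^ 4%:R :> R by rewrite powR_mulrn// -r2 -y2 -exprM.
  by rewrite -powRrM mul1r mulfV// powRr1.
rewrite yE in sy.
apply: (sync_sdp n0 uz hW W0 Ww s0 hx hlam lam0 he).
have sLr : sigma * L <= r / 18.
  have := ler_pM s0 L0 sy Ly; rewrite -mulrA -expr2 y2; lra.
have ssr : sigma ^+ 2 <= r / 324.
  have := ler_pM s0 s0 sy sy; rewrite -expr2 => h; apply: (le_trans h).
  have -> : 18^-1 * y * (18^-1 * y) = y ^+ 2 / 324 by field.
  by rewrite y2.
have yr : y * 10 <= r by rewrite -y2 expr2 ler_wpM2l.
have sw : sigma * w <= 18^-1 * (r / 10) * (17 / 4 * r).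
  by apply: ler_pM => //; lra.
have rr : r * 100 <= r * r by rewrite ler_wpM2l.
have rsL := ler_wpM2l r0 sLr; have rss := ler_wpM2l r0 ssr.
have se : sigma * e = 283 / 100 * (r * (sigma * L)) + 51 * (r * sigma ^+ 2).
  by rewrite /e; ring.
(* In multiples of n = r^2, the losses are at most 0.158 + 0.158 from sigma e, 0.024 from sigma w
   and 0.007 from (3/2) |x - z|^2, well below 1. *)
rewrite se hl -/w -r2; rewrite !expr2 in rss ssr del2 *.
by lra.
Qed.
End deterministic.

(** * Intersection of the two events and the conclusion *)

Theorem theorem1 (R : realType) :
  exists K : R, forall n : nat, (2 <= n)%N ->
  forall sigma : R, 0 <= sigma ->
  forall z : 'cV[R[i]]_n, unimodular z ->
  forall (d : measure_display) (T : measurableType d) (P : probability T R)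
         (g : bool -> 'I_n -> 'I_n -> {RV P >-> R}),
  wigner_gaussians g ->
  exists E : set T, measurable E /\
    (P E >= (1 - K * (n%:R `^ (- (5 / 4))))%:E)%E /\
    forall w, E w ->
    let C := z *m cadj z + (sigma%:C)%C *: wigner g w in
    forall x : 'cV[R[i]]_n,
      phase_sync_opt C x ->
      (cadj z *m x) 0 0 = `|(cadj z *m x) 0 0| ->
      (forall i, cabs (x i 0 - z i 0) <=
         6 * (Num.sqrt (ln (n%:R : R)) + 29 * sigma) * sigma / Num.sqrt (n%:R)) /\
      Num.sqrt (\sum_i cabs (x i 0 - z i 0) ^+ 2) <= 12 * sigma /\
      (sigma <= 18^-1 * n%:R `^ (1 / 4) -> sdp_unique_solution C (x *m cadj x)).
Proof.
pose K0 : R := (10 ^+ 4) ^+ 2; have K00 : 0 <= K0 by exact: sqr_ge0.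
(* For n < 10^4 the probability bound is at most 0, so the empty event works. *)
exists (102 + K0) => n n2 sigma s0 z uz d T P g hg.
have nR0 : 0 < n%:R :> R by rewrite ltr0n ltnW.
have nR1 : 1 <= n%:R :> R by rewrite ler1n ltnW.
have pw : (n%:R ^+ 2)^-1 <= n%:R `^ (- (5 / 4)) :> R.
  have -> : (n%:R ^+ 2)^-1 = n%:R `^ (- 2%:R) :> R by rewrite powRN powR_mulrn.
  by apply: ler_powR => //; lra.
have p0 : 0 < n%:R `^ (- (5 / 4)) :> R by exact: powR_gt0.
have [small|large] := ltnP n (10 ^ 4).
  exists set0; split; first exact: measurable0.
  split; last by move=> w [].
  rewrite measure0 lee_fin subr_le0.
  have h1 : 1 <= K0 * (n%:R ^+ 2)^-1.
    rewrite ler_pdivlMr ?exprn_gt0// mul1r; apply: lerXn2r; rewrite ?nnegrE//.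
    by rewrite -natrX ler_nat ltnW.
  have h2 : K0 * (n%:R ^+ 2)^-1 <= K0 * n%:R `^ (- (5 / 4)) by exact: ler_wpM2l.
  by move: K0 {K00} h1 h2 => K0 h1 h2; lra.
have [E1 [mE1 PE1 hE1]] := wigner_opnorm_event hg (ltnW n2).
have [E2 [mE2 PE2 hE2]] := wigner_entries_event hg uz n2.
exists (E1 `&` E2); split; first exact: measurableI.
split.
  have -> : P (E1 `&` E2) = (1 - P (~` (E1 `&` E2)))%E.
    by rewrite -probability_setC ?setCK//; exact/measurableC/measurableI.
  have PC (F : set T) (a : R) : measurable F -> ((1 - a)%:E <= P F)%E ->
      (P (~` F) <= a%:E)%E.
    move=> mF; rewrite probability_setC// -(fineK (fin_num_measure P F mF)).
    by rewrite -EFinB !lee_fin; lra.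
  have PC1 : (P (~` E1) <= (2 * (3 / 4) ^+ n)%:E)%E.
    exact: PC mE1 PE1.
  have PC2 : (P (~` E2) <= (4 / n%:R ^+ 2)%:E)%E.
    exact: PC mE2 PE2.
  have PU : (P (~` (E1 `&` E2)) <= (2 * (3 / 4) ^+ n + 4 / n%:R ^+ 2)%:E)%E.
    rewrite setCI EFinD; apply: (le_trans (measureU2 _ _ _)); try exact: measurableC.
    exact: leeD.
  apply: (@le_trans _ _ (1 - (2 * (3 / 4) ^+ n + 4 / n%:R ^+ 2)%:E)%E); last by rewrite leeB.
  rewrite -EFinB lee_fin lerB//.
  (* Altogether the failure probability is at most (2 * 49 + 4) / n^2, which explains 102. *)
  have h1 : (3 / 4) ^+ n <= 49 / n%:R ^+ 2 :> R.
    by rewrite ler_pdivlMr ?exprn_gt0// mulrC expr_three_quarters_le.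
  have h2 : 0 <= K0 * n%:R `^ (- (5 / 4)) by rewrite mulr_ge0// ltW.
  move: K0 {K00} h2 => K0 h2.
  move: ((3 / 4) ^+ n) ((n%:R ^+ 2)^-1) (n%:R `^ _) h1 h2 pw p0 => a b c.
  by move=> h1 h2 pw p0; lra.
move=> w [Ew1 Ew2] /= x hx hphase.
apply: sync_deterministic => //.
- move=> i j; rewrite !mxE.
  by have [ij|ji|_] := ltngtP i j; rewrite ?conjCK ?conjC0.
- by move=> i; rewrite wigner_diag.
- exact: hE1.
- exact: hE2.
Qed.
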